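(* Let $K$ be an infinite field. Let $\Delta$ be a simplicial complex on $[n]$, let $\Delta^e$ be the exterior algebraic shifted complex of $\Delta$ (over $K$), and let $\Delta^c$ be a combinatorial shifted complex of $\Delta$. Then $$\beta_{i\,i+j}(I_{\Delta^e}) \leq \beta_{i\,i+j}(I_{\Delta^c})$$ for all $i$ and $j$.
   Context: $[n]=\{1,\ldots,n\}$ and $S=K[x_1,\ldots,x_n]$ is the polynomial ring with each $\deg x_i=1$. For a homogeneous ideal $I\subset S$, $\beta_{ij}(I)=\dim_K \mathrm{Tor}^S_i(K,I)_j$ denotes the graded Betti numbers. A simplicial complex $\Delta$ on $[n]$ is a collection of subsets of $[n]$ with $\{j\}\in\Delta$ for all $j\in[n]$ and such that $\tau\subset\sigma\in\Delta$ implies $\tau\in\Delta$. Its Stanley–Reisner ideal $I_\Delta\subset S$ is generated by the squarefree monomials $x_\sigma=\prod_{k\in\sigma}x_k$ with $\sigma\subset[n]$, $\sigma\notin\Delta$. $\Delta$ is shifted if for each $\sigma\in\Delta$ and $i\in\sigma$ one has $(\sigma\setminus\{i\})\cup\{j\}\in\Delta$ for all $j>i$ with $j\notin\sigma$. Exterior shifting: let $V$ be a $K$-vector space with basis $e_1,\ldots,e_n$ and $E=\bigoplus_{d=0}^n\bigwedge^d(V)$ its exterior algebra. For $\sigma=\{j_1<\cdots<j_d\}\subset[n]$ put $e_\sigma=e_{j_1}\wedge\cdots\wedge e_{j_d}$ (a monomial of $E$ of degree $d$). The exterior face ideal $J_\Delta\subset E$ is generated by the $e_\sigma$ with $\sigma\notin\Delta$.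 Let $<_{\mathrm{rev}}$ be the reverse lexicographic order on $E$ induced by $e_1>\cdots>e_n$ (for $|\sigma|=|\tau|$, $\sigma\neq\tau$: $e_\tau<_{\mathrm{rev}}e_\sigma$ iff the largest element of the symmetric difference of $\sigma$ and $\tau$ belongs to $\tau$). The group $GL(n;K)$ acts linearly on $V$ and hence on $E$ by algebra automorphisms. For a homogeneous ideal $I\subset E$, the generic initial ideal $\mathrm{Gin}^E(I)$ is the common value of $\mathrm{in}_{<_{\mathrm{rev}}}(\varphi(I))$ for $\varphi$ in a suitable nonempty Zariski open subset of $GL(n;K)$. The exterior algebraic shifted complex $\Delta^e$ is the simplicial complex on $[n]$ with $J_{\Delta^e}=\mathrm{Gin}^E(J_\Delta)$. Combinatorial shifting: for $1\le i<j\le n$, $\mathrm{Shift}_{ij}(\Delta)$ is the simplicial complex on $[n]$ whose faces are the sets $C_{ij}(\sigma)$, $\sigma\in\Delta$, where $C_{ij}(\sigma)=(\sigma\setminus\{i\})\cup\{j\}$ if $i\in\sigma$, $j\notin\sigma$ and $(\sigma\setminus\{i\})\cup\{j\}\notin\Delta$, and $C_{ij}(\sigma)=\sigma$ otherwise. A combinatorial shifted complex $\Delta^c$ of $\Delta$ is any shifted complex of the form $\mathrm{Shift}_{i_qj_q}(\cdots(\mathrm{Shift}_{i_1j_1}(\Delta))\cdots)$ for a finite sequence of pairs $1\le i_k<j_k\le n$ (it exists but need not be unique). *)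

(* Defs.v *)
From Stdlib Require Import ClassicalEpsilon.
From HB Require Import structures.
From mathcomp Require Import all_boot all_order all_algebra.
From mathcomp Require Export mpoly.

Set Implicit Arguments.
Unset Strict Implicit.
Unset Printing Implicit Defensive.

Import Order.TTheory GRing.Theory.
Local Open Scope ring_scope.

Definition infinite_field (K : fieldType) : Prop :=
  forall s : seq K, exists x : K, x \notin s.

(* The vertex set [n] is 'I_n, so vertices are numbered 0..n-1. *)

Section Complexes.
Variable n : nat.
Implicit Types (D : {set {set 'I_n}}) (s : {set 'I_n}).

Definition simplicial_complex D : Prop :=
  (forall j : 'I_n, [set j] \in D) /\
  (forall s t : {set 'I_n}, s \in D -> t \subset s -> t \in D).

Definition shifted D : Prop :=
  forall s (i j : 'I_n),
    s \in D -> i \in s -> (i < j)%N -> j \notin s -> j |: (s :\ i) \in D.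

Definition shift_face (i j : 'I_n) D s : {set 'I_n} :=
  if [&& i \in s, j \notin s & j |: (s :\ i) \notin D]
  then j |: (s :\ i) else s.

Definition Shift (i j : 'I_n) D : {set {set 'I_n}} :=
  [set shift_face i j D s | s in D].

Definition combinatorial_shifted D Dc : Prop :=
  shifted Dc /\
  exists2 ij : seq ('I_n * 'I_n),
    all (fun p : 'I_n * 'I_n => (p.1 < p.2)%N) ij
    & Dc = foldl (fun D' (p : 'I_n * 'I_n) => Shift p.1 p.2 D') D ij.

End Complexes.


Definition ideal_gen (R : comNzRingType) (G : R -> Prop) (f : R) : Prop :=
  exists2 c : seq (R * R),
    (forall p, p \in c -> G p.2) & f = \sum_(p <- c) p.1 * p.2.

Definition stanley_reisner (K : fieldType) (n : nat) (D : {set {set 'I_n}})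
    : {mpoly K[n]} -> Prop :=
  ideal_gen (fun f => exists2 s : {set 'I_n}, s \notin D & f = \prod_(k in s) 'X_k).
Arguments stanley_reisner K {n} D.


(* b is the dimension of Z / B, for linear subspaces B of Z: there are b
   elements of Z whose classes form a basis of Z / B. *)
Definition is_quot_dim (K : fieldType) (V : lmodType K) (Z B : V -> Prop)
    (b : nat) : Prop :=
  exists v : 'I_b -> V,
    [/\ forall k, Z (v k),
        forall z, Z z -> exists c : 'I_b -> K, B (z - \sum_k c k *: v k)
      & forall c : 'I_b -> K, B (\sum_k c k *: v k) -> forall k, c k = 0].

Definition quot_dim (K : fieldType) (V : lmodType K) (Z B : V -> Prop) : nat :=
  epsilon (inhabits 0%N) (is_quot_dim Z B).

Section Koszul.
Variables (K : fieldType) (n : nat).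
Local Notation S := {mpoly K[n]}.

(* The free S-module on symbols e_s, s a subset of [n].  The e_s with
   #|s| = p generate its p-th component K_p, and e_s has internal degree p. *)
Definition koszul := {ffun {set 'I_n} -> S}.

Definition koszul_sign (k : 'I_n) (t : {set 'I_n}) : nat :=
  #|[set l in t | (l < k)%N]|.

(* The S-linear map e_{j_1 < ... < j_p} |->
   \sum_r (-1)^{r-1} x_{j_r} e_{j_1 ... ^j_r ... j_p}, in coordinates. *)
Definition koszul_d (v : koszul) : koszul :=
  [ffun t : {set 'I_n} =>
    \sum_(k | k \notin t) (-1) ^+ koszul_sign k t * 'X_k * v (k |: t)].

Definition in_hdeg (p : nat) (v : koszul) : Prop :=
  forall s : {set 'I_n}, #|s| <> p -> v s = 0.

(* The degree-j part of K_p (x)_S I.  As K_p is free on the e_s with #|s| = p,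
   this tensor product is the direct sum of copies I e_s. *)
Definition koszul_tensor (I : S -> Prop) (p j : nat) (v : koszul) : Prop :=
  [/\ in_hdeg p v, forall s, I (v s)
    & forall s, v s <> 0 -> (p <= j)%N /\ v s \is (j - p).-homog].

(* dim_K Tor^S_i(K, I)_j: Tor^S_i(K, I) is the i-th homology of
   (free resolution of K) (x)_S I, and the resolution used is the Koszul complex,
   which is a graded free resolution of K by koszul_dd, koszul_exact and
   koszul_augmentation below. *)
Definition betti (I : S -> Prop) (i j : nat) : nat :=
  quot_dim
    (fun v : koszul => koszul_tensor I i j v /\ koszul_d v = 0)
    (fun v : koszul => exists2 w, koszul_tensor I i.+1 j w & v = koszul_d w).

End Koszul.


Section Exterior.
Variables (K : fieldType) (n : nat).

(* The exterior algebra E of V = K^n; u : E stands for \sum_s (u s) e_s. *)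
Definition ext := {ffun {set 'I_n} -> K^o}.

Definition ext_monomial (s : {set 'I_n}) : ext := [ffun t => (t == s)%:R].

(* e_s /\ e_t = (-1)^(ext_sign s t) e_(s :|: t) for disjoint s and t, and 0
   otherwise. *)
Definition ext_sign (s t : {set 'I_n}) : nat :=
  #|[set p : 'I_n * 'I_n | [&& p.1 \in s, p.2 \in t & (p.2 < p.1)%N]]|.

Definition wedge (u v : ext) : ext :=
  [ffun r : {set 'I_n} =>
    \sum_(s : {set 'I_n} | s \subset r)
       (-1) ^+ ext_sign s (r :\: s) * u s * v (r :\: s)].

Definition ext_ideal_gen (G : ext -> Prop) (u : ext) : Prop :=
  exists2 c : seq (ext * ext * ext),
    (forall p, p \in c -> G p.1.2)
    & u = \sum_(p <- c) wedge (wedge p.1.1 p.1.2) p.2.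

Definition exterior_face_ideal (D : {set {set 'I_n}}) : ext -> Prop :=
  ext_ideal_gen (fun u => exists2 s, s \notin D & u = ext_monomial s).

(* e_t <_rev e_s, for s and t of the same cardinality. *)
Definition lt_rev (t s : {set 'I_n}) : bool :=
  [exists m : 'I_n,
     [&& m \in t, m \notin s
       & [forall l : 'I_n, (m < l)%N ==> ((l \in t) == (l \in s))]]].

Definition ext_homogeneous (d : nat) (u : ext) : Prop :=
  forall s : {set 'I_n}, u s <> 0 -> #|s| = d.

(* e_s is the initial monomial of the homogeneous element u. *)
Definition is_initial_monomial (u : ext) (s : {set 'I_n}) : Prop :=
  u s <> 0 /\ forall t, u t <> 0 -> t <> s -> lt_rev t s.

Definition initial_ideal (I : ext -> Prop) : ext -> Prop :=
  ext_ideal_gen (fun m => exists s u d,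
    [/\ I u, ext_homogeneous d u, is_initial_monomial u s
      & m = ext_monomial s]).

Definition gl_act_vector (g : 'M[K]_n) (i : 'I_n) : ext :=
  \sum_(k < n) g i k *: ext_monomial [set k].

(* The algebra endomorphism of E with e_i |-> \sum_k g_ik e_k; the enumeration
   of s is increasing. *)
Definition gl_act (g : 'M[K]_n) (u : ext) : ext :=
  \sum_(s : {set 'I_n})
    u s *: foldr wedge (ext_monomial set0) [seq gl_act_vector g i | i <- enum s].

Definition gl_act_ideal (g : 'M[K]_n) (I : ext -> Prop) (v : ext) : Prop :=
  exists2 u, I u & v = gl_act g u.

Definition zariski_open_GL (U : 'M[K]_n -> Prop) : Prop :=
  exists F : {mpoly K[n * n]} -> Prop,
    forall g : 'M[K]_n,
      U g <-> g \in unitmx /\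
              exists2 f, F f & f.@[fun k => mxvec g ord0 k] <> 0.

Definition is_gin (I J : ext -> Prop) : Prop :=
  exists U : 'M[K]_n -> Prop,
    [/\ zariski_open_GL U, exists g, U g
      & forall g, U g ->
          forall u, initial_ideal (gl_act_ideal g I) u <-> J u].

Definition exterior_shifted (D De : {set {set 'I_n}}) : Prop :=
  simplicial_complex De /\
  is_gin (exterior_face_ideal D) (exterior_face_ideal De).

End Exterior.


(* A dimension as in is_quot_dim is unique (apply twice). *)
Lemma is_quot_dim_le (K : fieldType) (V : lmodType K) (Z B : V -> Prop) b b' :
  B 0 -> (forall (a : K) x y, B x -> B y -> B (a *: x + y)) ->
  is_quot_dim Z B b -> is_quot_dim Z B b' -> (b <= b')%N.
Proof.
move=> B0 BL [v [vZ _ vF]] [w [_ wG _]].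
have BS (I : finType) (a : I -> K) (x : I -> V) :
    (forall k, B (x k)) -> B (\sum_k a k *: x k).
  by move=> Bx; elim/big_rec: _ => // k y _ By; apply: BL.
have [f fP] := fin_all_exists (fun k => wG _ (vZ k)).
pose A := \matrix_(k < b, l < b') f k l.
rewrite leqNgt; apply/negP => lt_b'b.
have /rowV0Pn[u /sub_kermxP uA u0] : kermx A != 0.
  rewrite -mxrank_eq0 mxrank_ker -lt0n subn_gt0.
  by rewrite (leq_ltn_trans (rank_leq_col _)).
case/negP: u0; apply/eqP/rowP => k; rewrite mxE.
apply: vF (fun k => u 0 k) _ k.
suff -> : \sum_k u 0 k *: v k = \sum_k u 0 k *: (v k - \sum_l f k l *: w l).
  exact: BS.
under [RHS]eq_bigr do rewrite scalerBr; rewrite sumrB.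
rewrite [X in _ = _ - X](_ : _ = 0) ?subr0 //.
under eq_bigr do rewrite scaler_sumr; rewrite exchange_big big1 //= => l _.
under eq_bigr do rewrite scalerA; rewrite -scaler_suml.
have := congr1 (fun M : 'rV_b' => M 0 l) uA.
by rewrite !mxE; under eq_bigr do rewrite mxE; move=> ->; rewrite scale0r.
Qed.

Section KoszulExact.
Variables (K : fieldType) (n : nat).
Local Notation S := {mpoly K[n]}.
Implicit Types (v w : koszul K n) (s t : {set 'I_n}) (m : 'X_{1..n}) (k l : 'I_n).

Let subUK k m : (0 < m k)%N -> (m - U_(k) + U_(k))%MM = m.
Proof.
move=> mk; rewrite submK //; apply/mnm_lepP => l; rewrite mnm1E.
by case: eqP => // <-.
Qed.

Let mcoeffXM k (p : S) m :
  ('X_k * p)@_m = if (0 < m k)%N then p@_(m - U_(k)) else 0.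
Proof.
case: ifP => [mk|/negbT].
  have -> : 'X_k * p = p * 'X_k by rewrite mulrC.
  by rewrite -{1}(subUK mk) addmC mcoeffMX.
rewrite -eqn0Ngt => /eqP mk; apply/eqP; rewrite mcoeff_eq0.
apply/negP => /msuppM_le /allpairsP[[a c] /= [+ _ def_m]].
rewrite msuppX inE => /eqP def_a; move: mk.
by rewrite def_m def_a mnmDE mnm1E eqxx.
Qed.

Let koszul_dE v t m :
  (koszul_d v t)@_m = \sum_(k | (k \notin t) && (0 < m k)%N)
     (-1) ^+ koszul_sign k t * (v (k |: t))@_(m - U_(k)).
Proof.
rewrite ffunE raddf_sum [RHS]big_mkcondr; apply: eq_bigr => k _ /=.
rewrite -mulrA -signr_odd mulr_sign -[in RHS]signr_odd mulr_sign.
by rewrite (fun_if (mcoeff m)) mcoeffN mcoeffXM; do 2?case: ifP => //; rewrite oppr0.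
Qed.

Let koszul_signU k l t : k \notin t ->
  koszul_sign l (k |: t) = ((k < l) + koszul_sign l t)%N.
Proof.
move=> kt; rewrite /koszul_sign; case: (ltnP k l) => kl.
  rewrite (_ : [set _ in _ | _] = k |: [set i in t | (i < l)%N]).
    by rewrite cardsU1 inE (negPf kt).
  by apply/setP => i; rewrite !inE; case: eqP => [->|] //=; rewrite kl (negPf kt).
rewrite add0n; apply: eq_card => i; rewrite !inE.
by case: eqP => [->|] //=; rewrite ltnNge kl andbF.
Qed.

Lemma koszul_dd v : koszul_d (koszul_d v) = 0.
Proof.
apply/ffunP => t; rewrite !ffunE.
pose F k l := (-1) ^+ koszul_sign k t * 'X_k *
  ((-1) ^+ koszul_sign l (k |: t) * 'X_l * v (l |: (k |: t))) : S.
have FN k l : k \notin t -> l \notin t -> k != l -> F k l = - F l k.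
  move=> kt lt kl; rewrite /F !koszul_signU // setUCA !exprD.
  have: ((k < l) (+) (l < k))%N by move: kl; rewrite -val_eqE /=; case: ltngtP.
  case: (k < l)%N; case: (l < k)%N => //= _; rewrite expr0 expr1 ?mul1r ?mulN1r;
  by rewrite ?(mulrN, mulNr, opprK) mulrCA.
rewrite (eq_bigr (fun k => \sum_(l | (l \notin t) && (k != l)) F k l)); last first.
  move=> k kt; rewrite ffunE mulr_sumr; apply: eq_bigl => l.
  by rewrite !inE negb_or andbC eq_sym.
transitivity (\sum_(k | k \notin t) \sum_(l | l \notin t)
   ((if (k < l)%N then F k l else 0) + (if (l < k)%N then F k l else 0))).
  apply: eq_bigr => k kt; rewrite big_mkcondr; apply: eq_bigr => l lt.
  case: (ltngtP k l) => [||/val_inj->]; rewrite ?eqxx ?addr0 ?add0r //.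
    by case: eqP => // ->; rewrite ltnn.
  by case: eqP => // ->; rewrite ltnn.
under eq_bigr do rewrite big_split; rewrite big_split /=.
rewrite [X in _ + X]exchange_big /= -big_split /= big1 // => k kt.
rewrite -big_split /= big1 // => l lt.
case: ifP => [kl|]; rewrite ?addr0 // FN ?addNr //.
by rewrite neq_ltn kl.
Qed.

(* Contracting homotopy: x^m e_s with least index k in supp(m) :|: s is sent
   to x^(m - k) e_(k |: s) if k \notin s, and to 0 otherwise. *)
Let first m s k := ((0 < m k)%N || (k \in s)) &&
  [forall l : 'I_n, (l < k)%N ==> (m l == 0%N) && (l \notin s)].

Let first_uniq m s k l : first m s k -> first m s l -> k = l.
Proof.
case/andP=> km /forallP kP /andP[lm /forallP lP]; apply/val_inj.
case: (ltngtP k l) => // [/(implyP (lP k))|/(implyP (kP l))] /andP[/eqP a c].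
  by move: km; rewrite a (negPf c).
by move: lm; rewrite a (negPf c).
Qed.

Let first_ex m s : (m != 0%MM) || (s != set0) -> exists k, first m s k.
Proof.
move=> ms; have [k0 Pk0] : exists k, (0 < m k)%N || (k \in s).
  case/orP: ms => [m0|/set0Pn[k ks]]; last by exists k; rewrite ks orbT.
  have [/existsP[k mk]|/existsPn mN] := boolP [exists k, (0 < m k)%N].
    by exists k; rewrite mk.
  case/eqP: m0; apply/mnmP => k; rewrite mnm0E; apply/eqP.
  by rewrite eqn0Ngt mN.
case: (@arg_minnP _ k0 (fun k => (0 < m k)%N || (k \in s)) (fun k => k : nat) Pk0).
move=> k Pk kmin; exists k; rewrite /first Pk; apply/forallP => l.
apply/implyP => lk; rewrite eqn0Ngt -negb_or; apply/negP => /kmin.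
by rewrite leqNgt lk.
Qed.

Let homotopy v : koszul K n := [ffun s : {set 'I_n} => \sum_(k in s)
  \sum_(m <- msupp (v (s :\ k)) | (0 < m k)%N && first m s k)
    (v (s :\ k))@_m *: 'X_[K, m - U_(k)]].

Let firstDU m s k l : k \in s -> first (m + U_(k))%MM s l = first m s l.
Proof.
move=> ks; have E i : (0 < (m + U_(k))%MM i)%N || (i \in s) = (0 < m i)%N || (i \in s).
  rewrite mnmDE mnm1E; case: eqP => [<-|_]; first by rewrite ks !orbT.
  by rewrite addn0.
rewrite /first E; congr (_ && _); apply: eq_forallb => i; congr (_ ==> _).
by rewrite !eqn0Ngt -!negb_or E.
Qed.

Let homotopyE v s m k : first m s k ->
  (homotopy v s)@_m = if k \in s then (v (s :\ k))@_(m + U_(k)) else 0.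
Proof.
move=> fk; rewrite ffunE raddf_sum /=.
have E l : l \in s -> (\sum_(m0 <- msupp (v (s :\ l)) | (0 < m0 l)%N && first m0 s l)
    (v (s :\ l))@_m0 *: 'X_[K, m0 - U_(l)])@_m
   = if first m s l then (v (s :\ l))@_(m + U_(l)) else 0.
  move=> ls; rewrite raddf_sum /= big_mkcond /=.
  rewrite (eq_bigr (fun m0 => if m0 == (m + U_(l))%MM then
     (if first m s l then (v (s :\ l))@_(m + U_(l)) else 0) else 0)); last first.
    move=> m0 _; case: eqP => [->|ne].
      rewrite firstDU // mnmDE mnm1E eqxx addn1 /=; case: ifP => // _.
      by rewrite mcoeffZ mcoeffX addmK eqxx mulr1.
    case: ifP => // /andP[m0l _]; rewrite mcoeffZ mcoeffX.
    by case: eqP => [def_m|]; rewrite ?mulr0 //; case: ne; rewrite -def_m subUK.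
  rewrite -big_mkcond /=; case: ifP => _; last by rewrite big1_eq.
  case: (boolP ((m + U_(l))%MM \in msupp (v (s :\ l)))) => [ml|ml].
    by rewrite -big_filter filter_pred1_uniq ?msupp_uniq // big_seq1.
  rewrite (memN_msupp_eq0 ml) big1_eq //.
rewrite (eq_bigr _ E); case: ifP => ks.
  rewrite (bigD1 k) //= fk big1 ?addr0 // => l /andP[ls lk].
  by case: ifP => // /(first_uniq fk) kl; rewrite kl eqxx in lk.
rewrite big1 // => l ls; case: ifP => // /(first_uniq fk) kl.
by rewrite -kl ks in ls.
Qed.

Let firstXU m t k l : k \notin t -> (0 < m k)%N ->
  first (m - U_(k))%MM (k |: t) l = first m t l.
Proof.
move=> kt mk; have E i : (0 < (m - U_(k))%MM i)%N || (i \in k |: t) = (0 < m i)%N || (i \in t).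
  rewrite mnmBE mnm1E !inE; case: eqP => [<-|/eqP ki]; first by rewrite eqxx mk orbT.
  by rewrite eq_sym (negPf ki) subn0.
rewrite /first E; congr (_ && _); apply: eq_forallb => i; congr (_ ==> _).
by rewrite !eqn0Ngt -!negb_or E.
Qed.

Let homotopyP v : koszul_d v = 0 -> (v set0)@_0%MM = 0 ->
  koszul_d (homotopy v) = v.
Proof.
move=> dv v0; apply/ffunP => t; apply/mpolyP => m; rewrite koszul_dE.
have [|] := boolP ((m != 0%MM) || (t != set0)); last first.
  rewrite negb_or !negbK => /andP[/eqP-> /eqP->]; rewrite v0 big1 // => k.
  by rewrite mnm0E andbF.
case/first_ex => l fl.
rewrite (eq_bigr (fun k => if l \in k |: t then (-1) ^+ koszul_sign k t *
     (v ((k |: t) :\ l))@_(m - U_(k) + U_(l)) else 0)); last first.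
  move=> k /andP[kt mk]; rewrite (homotopyE v (k := l)) ?firstXU //.
  by case: ifP; rewrite ?mulr0.
have sl k : first m t k -> koszul_sign k t = 0%N.
  case/andP=> _ /forallP kP; apply: eq_card0 => i; rewrite !inE.
  case: (boolP (i \in t)) => // it; case: ltnP => // /(implyP (kP i)).
  by rewrite it andbF.
have [lt|lt] := boolP (l \in t); last first.
  have ml : (0 < m l)%N by case/andP: fl; rewrite (negPf lt) orbF.
  rewrite (bigD1 l) ?lt //= setU11 sl // expr0 mul1r setU1K // subUK //.
  rewrite big1 ?addr0 // => k /andP[_ kl].
  by rewrite !inE eq_sym (negPf kl) (negPf lt).
have := congr1 (mcoeff (m + U_(l))) (congr1 (fun u : koszul K n => u (t :\ l)) dv).
rewrite koszul_dE ffunE mcoeff0 (bigD1 l) /=; last first.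
  by rewrite !inE eqxx mnmDE mnm1E eqxx addn1.
have sl' : koszul_sign l (t :\ l) = 0%N.
  apply/eqP; rewrite -leqn0 -(sl _ fl) subset_leq_card //.
  by apply/subsetP => i; rewrite !inE => /andP[/andP[_ ->] ->].
rewrite sl' expr0 mul1r setD1K // addmK => /eqP; rewrite addr_eq0 => /eqP->.
rewrite -sumrN; apply: eq_big => [k|k /andP[kt mk]].
  rewrite !inE mnmDE mnm1E; case: (eqVneq k l) => [->|kl]; first by rewrite lt !andbF.
  by rewrite ?addn0 ?andbT.
have kl : k != l by apply: contraNneq kt => ->.
have lk : (l < k)%N.
  case/andP: fl => _ /forallP/(_ k); rewrite eqn0Ngt mk /=.
  by case: ltngtP => // /val_inj e; rewrite e eqxx in kl.
rewrite !inE lt orbT -{1}(setD1K lt) koszul_signU ?inE ?eqxx // lk exprS mulN1r mulNr.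
congr (- (_ * _)).
have -> : (k |: t) :\ l = k |: t :\ l.
  by apply/setP => i; rewrite !inE; case: (eqVneq i k) => [->|]; rewrite ?kl.
congr (_ @_ _); apply/mnmP => i; rewrite !(mnmDE, mnmBE, mnm1E).
case: (eqVneq k i) => [<-|_]; last by rewrite !subn0.
by rewrite eq_sym (negPf kl) !addn0.
Qed.

Let homotopy_hdeg p v : in_hdeg p v -> in_hdeg p.+1 (homotopy v).
Proof.
move=> vp s sp; rewrite ffunE big1 // => k ks; rewrite vp ?msupp0 ?big_nil //.
by move=> e; apply: sp; rewrite (cardsD1 k) ks e.
Qed.

Lemma koszul_d_hdeg p v : in_hdeg p.+1 v -> in_hdeg p (koszul_d v).
Proof.
move=> vp t tp; rewrite ffunE big1 // => k kt; rewrite vp ?mulr0 //.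
by rewrite cardsU1 kt => -[].
Qed.

Lemma koszul_exact p v : in_hdeg p.+1 v -> koszul_d v = 0 ->
  exists2 w, in_hdeg p.+2 w & v = koszul_d w.
Proof.
move=> vp dv; exists (homotopy v); first exact: homotopy_hdeg.
by rewrite homotopyP // vp ?cards0 // mcoeff0.
Qed.

(* K_0 = S e_0 maps onto K = S / (x_1, ..., x_n) by the constant coefficient,
   with kernel the image of K_1. *)
Lemma koszul_augmentation v : in_hdeg 0 v ->
  (v set0)@_0%MM = 0 <-> exists2 w, in_hdeg 1 w & v = koszul_d w.
Proof.
move=> vp; split=> [v0|[w _ ->]].
  exists (homotopy v); first exact: homotopy_hdeg.
  rewrite homotopyP //; apply/ffunP => t; rewrite !ffunE big1 // => k kt.
  by rewrite vp ?mulr0 // cardsU1 kt.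
by rewrite koszul_dE big1 // => k; rewrite mnm0E andbF.
Qed.

End KoszulExact.

Section ExteriorChecks.
Variables (K : fieldType) (n : nat).
Implicit Types s t : {set 'I_n}.
Local Notation e := (@ext_monomial K n).

Lemma wedge_monomial s t :
  wedge (e s) (e t) =
  if [disjoint s & t] then (-1) ^+ ext_sign s t *: e (s :|: t) else 0.
Proof.
apply/ffunP => r; rewrite ffunE.
rewrite (eq_bigr (fun s' => if s' == s then
    if r :\: s == t then (-1) ^+ ext_sign s t else 0 else 0)); last first.
  move=> s' _; rewrite !ffunE; case: eqP => [->|_]; rewrite ?mulr0 ?mul0r //.
  by case: eqP => [->|_]; rewrite ?mulr0 ?mulr1.
rewrite -big_mkcondr /= big_mkcond (bigD1 s) //= eqxx andbT big1 ?addr0; last first.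
  by move=> s' /negPf->; rewrite andbF.
rewrite -if_and; have -> : (s \subset r) && (r :\: s == t) = [disjoint s & t] && (r == s :|: t).
  apply/andP/andP => [[sr /eqP<-]|[st /eqP->]].
    split; first by rewrite disjoints_subset setCD subsetUr.
    by rewrite -{1}(setID r s) (setIidPr sr).
  rewrite subsetUl setDUl setDv set0U; split=> //.
  by apply/eqP/setDidPl; rewrite disjoint_sym.
case: ifP => [/andP[-> /eqP->]|].
  by rewrite !ffunE eqxx /= [RHS]mulr1.
by case: ifP => /= _; rewrite !ffunE // => ->; rewrite scaler0.
Qed.

Lemma gl_act1 (u : ext K n) : gl_act 1%:M u = u.
Proof.
have V i : gl_act_vector (K := K) 1%:M i = e [set i].
  rewrite /gl_act_vector (bigD1 i) //= mxE eqxx scale1r big1 ?addr0 // => k.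
  by rewrite mxE eq_sym => /negPf->; rewrite scale0r.
have W (l : seq 'I_n) : sorted (fun i j : 'I_n => (i < j)%N) l ->
    foldr (@wedge K n) (e set0) [seq gl_act_vector 1%:M i | i <- l] = e [set:: l].
  elim: l => [|i l IHl] /= il; first by rewrite set_nil.
  have lt_il : all (fun j : 'I_n => (i < j)%N) l.
    by apply: order_path_min il => ? ? ?; apply: ltn_trans.
  rewrite IHl ?(path_sorted il) // V wedge_monomial set_cons.
  have -> : ext_sign [set i] [set:: l] = 0%N.
    apply: eq_card0 => -[a b]; rewrite !inE /=; apply/and3P => -[/eqP-> bl].
    by rewrite ltnNge ltnW // (allP lt_il).
  rewrite expr0 scale1r disjoints1 inE ifT //.
  by apply/negP => /(allP lt_il); rewrite ltnn.
have E t : sorted (fun i j : 'I_n => (i < j)%N) (enum t).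
  rewrite -(sorted_map (f := val) (e' := ltn)) -[enum _](eq_filter (mem_enum _)).
  rewrite -(eq_filter (mem_map val_inj _)) -filter_map.
  by rewrite (sorted_filter ltn_trans) // unlock val_ord_enum iota_ltn_sorted.
apply/ffunP => t; rewrite /gl_act sum_ffunE (bigD1 t) //= big1 ?addr0.
  rewrite W; first by rewrite set_enum !ffunE eqxx; exact: mulr1.
  exact: E.
move=> s st; rewrite W; last first.
  exact: E.
by rewrite set_enum !ffunE eq_sym (negPf st); exact: mulr0.
Qed.
End ExteriorChecks.

(* Main.v *)
From HB Require Import structures.
Require Import Defs.
From mathcomp Require Import all_boot all_order all_algebra.
From Stdlib Require Import ClassicalEpsilon.
From mathcomp Require Import ring zify.

(** Write a_k(d) for the number of nonfaces with d elements of a complex all of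
    whose elements are smaller than k (vertices are numbered from 0).  The proof
    compares these numbers for the exterior shifted complex De and for a
    combinatorial shifted complex Dc, and shows that they determine the graded
    Betti numbers of a shifted complex in a monotone way.

    Betti numbers.  If a nonempty complex is shifted, its minimal nonfaces are the sets
    k |: T with T a face below k and k |: T a nonface.  The chain
    x_T e_(k |: s), for s below k and disjoint from T, has its Koszul boundary
    in the Stanley-Reisner ideal, and these boundaries form a basis of the Koszul
    homology of the ideal ([betti_critical]).  Hence a minimal nonface k |: T
    with d + 1 elements contributes C(k - d, i) to the i-th Betti number
    ([card_critical]), and there are a_(k+1)(d+1) - a_k(d+1) - a_k(d) of them for
    given k ([card_nonfaces_below]).  Summation by parts shows that the Betti
    numbers decrease when the a_k increase and the total number of nonfaces of
    each size is kept ([weighted_increments_le]).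

    Generic ranks.  Let J be the exterior face ideal of D.  The subsets of
    [0, k) are the largest monomials for the reverse lexicographic order, so the
    number of initial monomials of g J of degree d among them is the rank of the
    projection of (g J)_d to their span.  Along a line of matrices this rank is
    lower semicontinuous ([frank_semicont]); therefore a_k(d) for De is the
    maximum of these ranks over all matrices g ([gin_generic]).

    Shifting as a degeneration.  The face ideal of Shift i j D is the limit for
    t -> 0 of the image of J under e_j |-> e_i + t e_j.  By semicontinuity the
    maximal rank for Shift i j D is at most the one for D ([proj_rank_Shift]).
    Starting from Dc and the identity matrix, for which the rank is a_k(d) of Dc,
    this gives a_k(d) of Dc <= a_k(d) of De ([gin_nonfaces_ge]).  Both complexes
    have as many nonfaces of size d as D has.

    It remains to know that De is shifted.  This is also a maximality argument:
    if it failed, applying e_j |-> e_j + t e_i would produce a matrix of larger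
    rank than the generic one ([gin_shifted]). *)

Set Implicit Arguments.
Unset Strict Implicit.
Unset Printing Implicit Defensive.

Import Order.TTheory GRing.Theory.

(** * Polynomial functions of one parameter *)

Section PolyFun.
Local Open Scope ring_scope.
Variable K : fieldType.
(** Stated as a property of functions, so that objects defined over a field,
    such as [gl_act], need not be redefined over a polynomial ring. *)
Definition polyfun (h : K -> K) := exists p : {poly K}, forall t, h t = p.[t].

Lemma polyfun_const c : polyfun (fun=> c).
Proof. by exists c%:P => t; rewrite hornerC. Qed.

Lemma polyfun_id : polyfun id.
Proof. by exists 'X => t; rewrite hornerX. Qed.

Lemma polyfunD f h : polyfun f -> polyfun h -> polyfun (fun t => f t + h t).
Proof. by move=> [p fp] [q hq]; exists (p + q) => t; rewrite hornerD fp hq. Qed.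

Lemma polyfunM f h : polyfun f -> polyfun h -> polyfun (fun t => f t * h t).
Proof. by move=> [p fp] [q hq]; exists (p * q) => t; rewrite hornerM fp hq. Qed.

Lemma polyfun_sum (I : Type) (r : seq I) (P : pred I) (F : I -> K -> K) :
  (forall i, polyfun (F i)) -> polyfun (fun t => \sum_(i <- r | P i) F i t).
Proof.
move=> Fp; elim: r => [|i r [p IH]].
  by exists 0 => t; rewrite big_nil horner0.
have [q Fq] := Fp i; exists (if P i then q + p else p) => t.
by rewrite big_cons; case: ifP => _; rewrite ?hornerD ?Fq IH.
Qed.

Lemma polyfun_prod (I : Type) (r : seq I) (P : pred I) (F : I -> K -> K) :
  (forall i, polyfun (F i)) -> polyfun (fun t => \prod_(i <- r | P i) F i t).
Proof.
move=> Fp; elim: r => [|i r [p IH]].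
  by exists 1 => t; rewrite big_nil hornerC.
have [q Fq] := Fp i; exists (if P i then q * p else p) => t.
by rewrite big_cons; case: ifP => _; rewrite ?hornerM ?Fq IH.
Qed.

Lemma polyfunX f m : polyfun f -> polyfun (fun t => f t ^+ m).
Proof. by move=> [p fp]; exists (p ^+ m) => t; rewrite horner_exp fp. Qed.

Lemma polyfun_det n (M : K -> 'M[K]_n) :
  (forall a b, polyfun (fun t => M t a b)) -> polyfun (fun t => \det (M t)).
Proof.
move=> Mp; apply: polyfun_sum => s; apply: polyfunM (polyfun_const _) _.
exact: polyfun_prod.
Qed.

Lemma polyfun_meval n (f : {mpoly K[n]}) (x : K -> 'I_n -> K) :
  (forall k, polyfun (fun t => x t k)) -> polyfun (fun t => f.@[x t]).
Proof.
move=> xp.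
have [p fp] : polyfun (fun t => \sum_(m <- msupp f) f@_m * \prod_i x t i ^+ m i).
  apply: polyfun_sum => m; apply: polyfunM (polyfun_const _) _.
  by apply: polyfun_prod => i; apply: polyfunX.
by exists p => t; rewrite mevalE fp.
Qed.

Lemma infinite_nonroot (p : {poly K}) :
  infinite_field K -> p != 0 -> exists t, p.[t] != 0.
Proof.
move=> Kinf p0.
have [rs urs szr] : exists2 rs : seq K, uniq rs & size rs = size p.
  elim: (size p) => [|m [rs urs <-]]; first by exists [::].
  by have [x xrs] := Kinf rs; exists (x :: rs); rewrite //= xrs.
have [/(max_poly_roots p0)/(_ urs)|/allPn[t _ pt]] := boolP (all (root p) rs).
  by rewrite szr ltnn.
by exists t.
Qed.

End PolyFun.

(** * Rank of a finite family of vectors and its semicontinuity *)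

Section FamilyRank.
Local Open Scope ring_scope.
Variable K : fieldType.

Definition frank (T T' : finType) (f : T -> T' -> K) : nat :=
  \rank (\matrix_(a < #|T|, b < #|T'|) f (enum_val a) (enum_val b)).

Lemma sum_enum_val (T : finType) (F : T -> K) :
  \sum_(a < #|T|) F (enum_val a) = \sum_a F a.
Proof. by rewrite [RHS](reindex _ (onW_bij _ (enum_val_bij T))). Qed.

Lemma frank_comb (S T T' : finType) (f : S -> T' -> K) (f' : T -> T' -> K)
    (c : S -> T -> K) :
  (forall s b, f s b = \sum_a c s a * f' a b) -> (frank f <= frank f')%N.
Proof.
move=> fE; pose C := \matrix_(s < #|S|, a < #|T|) c (enum_val s) (enum_val a).
rewrite /frank; set M := (X in (\rank X <= _)%N); set M' := (X in (_ <= \rank X)%N).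
rewrite (_ : M = C *m M'); first exact: mxrankM_maxr.
apply/matrixP=> s b; rewrite !mxE fE -(sum_enum_val (fun a => c _ a * f' a _)).
by apply: eq_bigr => a _; rewrite !mxE.
Qed.

Lemma frank_kernel (T T1 T2 : finType) (f1 : T -> T1 -> K) (f2 : T -> T2 -> K) :
  (forall c : T -> K, (forall b, \sum_a c a * f2 a b = 0) ->
     forall b, \sum_a c a * f1 a b = 0) ->
  (frank f1 <= frank f2)%N.
Proof.
move=> kerf; rewrite /frank.
set M1 := (X in (\rank X <= _)%N); set M2 := (X in (_ <= \rank X)%N).
have E (T0 : finType) (f : T -> T0 -> K) (c : 'rV_#|T|) b :
    (c *m \matrix_(a < #|T|, b < #|T0|) f (enum_val a) (enum_val b)) 0 (enum_rank b)
     = \sum_a c 0 (enum_rank a) * f a b.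
  rewrite !mxE -(sum_enum_val (fun a => c 0 (enum_rank a) * f a b)); apply: eq_bigr => a _.
  by rewrite !mxE enum_valK enum_rankK.
have: (kermx M2 <= kermx M1)%MS.
  apply/rV_subP => c /sub_kermxP cM; apply/sub_kermxP/rowP => b.
  rewrite -(enum_valK b) E [RHS]mxE; apply: kerf (fun a => c 0 (enum_rank a)) _ _.
  by move=> b'; rewrite -E -/M2 cM mxE.
move/mxrankS; rewrite !mxrank_ker leq_sub2lE ?rank_leq_row //.
Qed.

Lemma frank_card (T T' : finType) (f : T -> T' -> K) (A : {set T'}) :
  (forall a b, b \notin A -> f a b = 0) -> (frank f <= #|A|)%N.
Proof.
move=> fA; pose f' a (b : 'I_#|A|) := f a (enum_val b).
apply: (@leq_trans (frank f')); last first.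
  by rewrite (leq_trans (rank_leq_col _)) // card_ord.
apply: frank_kernel => c cf b; have [bA|bA] := boolP (b \in A).
  by rewrite -(enum_rankK_in bA bA); apply: cf.
by rewrite big1 // => a _; rewrite fA ?mulr0.
Qed.

Lemma frank_indep (T T' : finType) (f : T -> T' -> K) :
  (forall c : T -> K, (forall b, \sum_a c a * f a b = 0) -> forall a, c a = 0) ->
  (#|T| <= frank f)%N.
Proof.
move=> fI; pose f1 (a b : T) : K := (a == b)%:R.
have E (c : T -> K) b : \sum_a c a * f1 a b = c b.
  rewrite (bigD1 b) //= /f1 eqxx mulr1 big1 ?addr0 // => a /negPf->.
  by rewrite mulr0.
apply: (@leq_trans (frank f1)); last first.
  by apply: frank_kernel => c /fI c0 b; rewrite big1 // => a _; rewrite c0 mul0r.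
suff: \rank (1%:M : 'M[K]_#|T|) = frank f1 by rewrite mxrank1 => <-.
congr (\rank _); apply/matrixP => a b.
by rewrite !mxE /f1 (inj_eq enum_val_inj).
Qed.

(** Constant matrices L and R reduce the matrix at t0 to an identity block of
    size its rank.  The determinant of L (f t) R is a polynomial in t, nonzero at
    t0, and where it is nonzero the rank is at least that of the block. *)
Lemma frank_semicont (T T' : finType) (f : K -> T -> T' -> K) t0 :
  (forall a b, polyfun (fun t => f t a b)) ->
  exists2 p : {poly K}, p != 0 &
    forall t, p.[t] != 0 -> (frank (f t0) <= frank (f t))%N.
Proof.
move=> fp; pose M t := \matrix_(a < #|T|, b < #|T'|) f t (enum_val a) (enum_val b).
pose r := \rank (M t0).
pose L : 'M[K]_(r, #|T|) := pid_mx r *m invmx (col_ebase (M t0)).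
pose R : 'M[K]_(#|T'|, r) := invmx (row_ebase (M t0)) *m pid_mx r.
have LMR : L *m M t0 *m R = 1%:M.
  rewrite -[in LHS](mulmx_ebase (M t0)) /L /R !mulmxA mulmxKV ?col_ebase_unit //.
  rewrite mulmxK ?row_ebase_unit // !mul_pid_mx !minnn.
  by rewrite (minn_idPr (rank_leq_row _)) minnn (minn_idPr (rank_leq_col _)) pid_mx_1.
have [p pE] : polyfun (fun t => \det (L *m M t *m R)).
  apply: polyfun_det => a b.
  have [q qE] : polyfun (fun t => \sum_k (\sum_l L a l * M t l k) * R k b).
    apply: polyfun_sum => k; apply: polyfunM (polyfun_const _).
    apply: polyfun_sum => l; apply: polyfunM (polyfun_const _) _.
    by have [q qE] := fp (enum_val l) (enum_val k); exists q => t; rewrite mxE.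
  exists q => t; rewrite -qE mxE; apply: eq_bigr => k _; congr (_ * _).
  by rewrite mxE.
exists p => [|t].
  by apply: contra_eq_neq (det1 K r) => p0; rewrite -LMR pE p0 horner0 eq_sym oner_eq0.
rewrite -pE -unitfE -unitmxE => /mxrank_unit rE.
rewrite -/(frank _) /frank -/(M t) -/(M t0) -/r -{1}rE.
by rewrite (leq_trans (mxrankM_maxl _ _)) // mxrankM_maxr.
Qed.

End FamilyRank.

(** * Left multiplication by vectors and the action of matrices on the exterior algebra *)

Section LeftWedge.
Local Open Scope ring_scope.
Variables (K : fieldType) (n : nat).
Implicit Types (s t r : {set 'I_n}) (k l : 'I_n) (u v : ext K n) (x y : 'rV[K]_n)
  (g h : 'M[K]_n).
Local Notation e := (@ext_monomial K n).

Lemma ext_decomp u : u = \sum_s u s *: e s.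
Proof.
apply/ffunP => t; rewrite sum_ffunE (bigD1 t) //= big1 ?addr0.
  by rewrite !ffunE eqxx; exact/esym/mulr1.
by move=> s st; rewrite !ffunE eq_sym (negPf st); exact: mulr0.
Qed.

Lemma ext_linE (a : K) u v s : (a *: u + v) s = a * u s + v s.
Proof. by rewrite !ffunE. Qed.

Definition lvec x : ext K n := \sum_k x 0 k *: e [set k].

(** Working only with these left multiplications by vectors spares the
    associativity of [wedge]. *)
Definition lwedge x u : ext K n := wedge (lvec x) u.

Lemma gl_act_vectorE (g : 'M[K]_n) k : gl_act_vector g k = lvec (row k g).
Proof. by apply: eq_bigr => l _; rewrite mxE. Qed.

Lemma lwedgeE x u r :
  lwedge x u r = \sum_(k in r) (-1) ^+ koszul_sign k r * x 0 k * u (r :\ k).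
Proof.
rewrite ffunE; transitivity (\sum_(s : {set 'I_n} | s \subset r) \sum_k
    if s == [set k] then (-1) ^+ ext_sign s (r :\: s) * x 0 k * u (r :\: s) else 0).
  apply: eq_bigr => s _; rewrite sum_ffunE mulr_sumr mulr_suml.
  apply: eq_bigr => k _; rewrite !ffunE; case: eqP => _.
    by congr (_ * _ * _); exact: mulr1.
  by rewrite [_ *: _]mulr0 mulr0 mul0r.
rewrite exchange_big [RHS]big_mkcond; apply: eq_bigr => k _ /=.
rewrite -big_mkcondr /=; case: ifP => kr.
  rewrite (big_pred1 [set k]) => [|s]; last first.
    by rewrite /= andbC; case: eqP => //= ->; rewrite sub1set kr.
  congr ((-1) ^+ _ * _ * _); rewrite /ext_sign /koszul_sign.
  rewrite -(card_imset [set l in r | _] (f := pair k)); last by move=> ? ? [].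
  apply: eq_card => -[a b]; rewrite !inE; apply/and3P/imsetP => /= [[/eqP-> /andP[bk br] lt_bk]|].
    by exists b; rewrite // inE br.
  case=> l; rewrite inE => /andP[lr lt_lk] [-> ->]; rewrite eqxx lr lt_lk andbT.
  by split=> //; apply: contraTN lt_lk => /eqP->; rewrite ltnn.
rewrite big_pred0 // => s; apply/negP => /andP[+ /eqP ds].
by rewrite ds sub1set kr.
Qed.

Lemma lwedge_is_linear x : linear (lwedge x).
Proof.
move=> a u v; apply/ffunP => r; rewrite ext_linE !lwedgeE mulr_sumr -big_split.
by apply: eq_bigr => k _; rewrite ext_linE mulrDr mulrCA.
Qed.

HB.instance Definition _ x :=
  GRing.isLinear.Build K (ext K n) (ext K n) _ (lwedge x) (lwedge_is_linear x).

Lemma lwedge_linearl a x y u :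
  lwedge (a *: x + y) u = a *: lwedge x u + lwedge y u.
Proof.
apply/ffunP => r; rewrite ext_linE !lwedgeE mulr_sumr -big_split.
apply: eq_bigr => k _; rewrite !mxE mulrDr mulrDl; congr (_ + _).
by rewrite mulrCA -!mulrA.
Qed.

Lemma lwedge_suml (I : finType) (c : I -> K) (x : I -> 'rV[K]_n) u :
  lwedge (\sum_i c i *: x i) u = \sum_i c i *: lwedge (x i) u.
Proof.
elim/big_rec2: _ => [|i v y _ <-]; last by rewrite lwedge_linearl.
by apply/ffunP => r; rewrite lwedgeE ffunE big1 // => k _; rewrite mxE mulr0 mul0r.
Qed.

Lemma koszul_signD1 k l r : k \in r ->
  koszul_sign l r = ((k < l) + koszul_sign l (r :\ k))%N.
Proof.
move=> kr; rewrite /koszul_sign (cardsD1 k) inE kr /=; congr (_ + _)%N.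
by apply: eq_card => i; rewrite !inE andbA.
Qed.

(** The terms for (k, l) and (l, k) cancel.  This form, unlike
    anticommutation, is strong enough in characteristic 2, and anticommutation
    follows from it by polarization. *)
Lemma lwedge_sqr0 x u : lwedge x (lwedge x u) = 0.
Proof.
apply/ffunP => r; rewrite lwedgeE ffunE.
pose F k l : K := (-1) ^+ koszul_sign k r * x 0 k *
  ((-1) ^+ koszul_sign l (r :\ k) * x 0 l * u (r :\ k :\ l)).
have FN k l : k \in r -> l \in r -> (k < l)%N -> F k l + F l k = 0.
  move=> kr lr kl; rewrite /F (koszul_signD1 k lr) (koszul_signD1 l kr) kl.
  rewrite [(l < k)%N]ltnNge ltnW // add0n add1n exprS.
  have -> : r :\ k :\ l = r :\ l :\ k by apply/setP => i; rewrite !inE andbCA.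
  set a := (-1) ^+ _; set b := (-1) ^+ _; ring.
transitivity (\sum_(k in r) \sum_(l in r)
   ((if (k < l)%N then F k l else 0) + (if (l < k)%N then F k l else 0))).
  apply: eq_bigr => k kr; rewrite lwedgeE mulr_sumr big_mkcond [RHS]big_mkcond.
  apply: eq_bigr => l _; rewrite !inE; case: ifP => [/andP[lk ->]|].
    by move: lk; rewrite -val_eqE /=; case: ltngtP; rewrite ?addr0 ?add0r.
  case: (l \in r) => //; rewrite andbT => /negbFE/eqP->.
  by rewrite ltnn addr0.
under eq_bigr do rewrite big_split; rewrite big_split /=.
rewrite [X in _ + X]exchange_big /= -big_split /= big1 // => k kr.
rewrite -big_split /= big1 // => l lr.
by case: ifP => [/(FN _ _ kr lr)//|_]; rewrite addr0.
Qed.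

Lemma lwedge_anticomm x y u : lwedge x (lwedge y u) = - lwedge y (lwedge x u).
Proof.
have := lwedge_sqr0 (1 *: x + y) u.
rewrite !lwedge_linearl !scale1r !linearD /= !lwedge_sqr0 add0r addr0.
by move/eqP; rewrite addrC addr_eq0 => /eqP->; rewrite opprK.
Qed.

Definition lprod (g : 'M[K]_n) (l : seq 'I_n) : ext K n :=
  foldr lwedge (e set0) [seq row i g | i <- l].

Lemma gl_actE g u : gl_act g u = \sum_s u s *: lprod g (enum s).
Proof.
apply: eq_bigr => s _; congr (_ *: _); rewrite /lprod.
by elim: (enum s) => //= i l ->; rewrite gl_act_vectorE.
Qed.

Lemma gl_act_is_linear g : linear (gl_act g).
Proof.
move=> a u v; rewrite !gl_actE scaler_sumr -big_split; apply: eq_bigr => s _.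
by rewrite !ffunE scalerDl scalerA.
Qed.

HB.instance Definition _ g :=
  GRing.isLinear.Build K (ext K n) (ext K n) _ (gl_act g) (gl_act_is_linear g).

Lemma gl_act_monomial g s : gl_act g (e s) = lprod g (enum s).
Proof.
rewrite gl_actE (bigD1 s) //= ffunE eqxx scale1r big1 ?addr0 // => t st.
by rewrite ffunE (negPf st) scale0r.
Qed.

Lemma gl_act_sum g u : gl_act g u = \sum_s u s *: gl_act g (e s).
Proof. by rewrite gl_actE; apply: eq_bigr => s _; rewrite gl_act_monomial. Qed.

Lemma eq_gl_act_monomial g h s :
  {in s, forall k, row k g = row k h} -> gl_act g (e s) = gl_act h (e s).
Proof.
move=> gh; rewrite !gl_act_monomial /lprod; congr foldr.
by apply/eq_in_map => k; rewrite mem_enum => /gh.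
Qed.

Let insert k (l : seq 'I_n) : seq 'I_n :=
  [seq i : 'I_n <- l | (i < k)%N] ++ k :: [seq i : 'I_n <- l | (k < i)%N].

Let ltI (i j : 'I_n) := (i < j)%N.

Let ltI_trans : transitive ltI.
Proof. by move=> ? ? ?; apply: ltn_trans. Qed.

Let enum_sorted s : sorted ltI (enum s).
Proof.
rewrite -(sorted_map (f := val) (e' := ltn)) -[enum _](eq_filter (mem_enum _)).
rewrite -(eq_filter (mem_map val_inj _)) -filter_map.
by rewrite (sorted_filter ltn_trans) // unlock val_ord_enum iota_ltn_sorted.
Qed.

Let enum_insert k s : k \notin s -> enum (k |: s) = insert k (enum s).
Proof.
move=> ks; apply: (irr_sorted_eq ltI_trans) => [i|||i].
- exact: ltnn.
- exact: enum_sorted.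
- rewrite sorted_pairwise // pairwise_cat /=.
  have pw P : pairwise ltI [seq i <- enum s | P i].
    by rewrite -sorted_pairwise // (sorted_filter ltI_trans) // enum_sorted.
  rewrite !pw /= andbT; apply/andP; split.
    apply/allrelP => a b; rewrite mem_filter inE => /andP[ak _].
    case/predU1P => [->//|]; rewrite mem_filter => /andP[kb _].
    exact: ltn_trans kb.
  by apply/allP => a; rewrite mem_filter => /andP[].
- rewrite mem_enum mem_cat in_cons !(mem_filter _ _ (enum s)) !mem_enum !inE.
  rewrite orbCA -andb_orl -neq_ltn.
  by have [->|ik] := eqVneq i k; rewrite //= -[_ != _]/(i != k) ik.
Qed.

Let lwedge_lprod_mem g k (l : seq 'I_n) : k \in l -> lwedge (row k g) (lprod g l) = 0.
Proof.
elim: l => //= i l IHl; rewrite inE; case: eqP => [->|_ /IHl kl].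
  by rewrite /lprod /= lwedge_sqr0.
by rewrite /lprod /= lwedge_anticomm -/(lprod g l) kl linear0 oppr0.
Qed.

Let lwedge_lprod g k (l : seq 'I_n) : sorted ltI l -> k \notin l ->
  lwedge (row k g) (lprod g l)
    = (-1) ^+ count (ltI^~ k) l *: lprod g (insert k l).
Proof.
elim: l => [|i l IHl] /=; first by rewrite expr0 scale1r.
move=> il; rewrite inE negb_or => /andP[ki kl].
have lt_il : all (ltI i) l by apply: order_path_min il; apply: ltI_trans.
move: ki; rewrite -val_eqE /ltI /insert /=; case: (ltngtP k i) => // [lt_ki|lt_ik] _.
  have lt_kl : {in l, forall j : 'I_n, (k < j)%N}.
    by move=> j /(allP lt_il); apply: ltn_trans.
  have -> : [seq j : 'I_n <- l | (j < k)%N] = [::].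
    rewrite (eq_in_filter (a2 := pred0)) ?filter_pred0 // => j /lt_kl.
    by case: ltngtP.
  have -> : [seq j : 'I_n <- l | (k < j)%N] = l.
    by rewrite (eq_in_filter (a2 := predT)) ?filter_predT.
  have -> : count (fun j : 'I_n => (j < k)%N) l = 0%N.
    by rewrite (@eq_in_count _ _ pred0) ?count_pred0 // => j /lt_kl; case: ltngtP.
  by rewrite expr0 scale1r.
rewrite /lprod /= lwedge_anticomm -!/(lprod _ _) IHl ?(path_sorted il) //.
by rewrite linearZ /= exprS mulN1r scaleNr.
Qed.

(** Row k is moved past the rows of smaller index, at the cost of one sign
    each.  The sign does not depend on g, and g = 1 gives the product of monomials;
    this is why [gl_act g] is multiplicative. *)
Lemma lwedge_gl_act_monomial g k s :
  lwedge (row k g) (gl_act g (e s))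
    = if k \in s then 0 else (-1) ^+ koszul_sign k s *: gl_act g (e (k |: s)).
Proof.
rewrite !gl_act_monomial; case: ifP => ks.
  by rewrite lwedge_lprod_mem ?mem_enum.
rewrite enum_insert ?ks // lwedge_lprod ?enum_sorted ?mem_enum ?ks //.
congr ((-1) ^+ _ *: _); rewrite /koszul_sign -sum1_card -sum1_count.
by rewrite big_enum_cond; apply: eq_bigl => i; rewrite inE.
Qed.

Lemma lwedge_monomial k s :
  lwedge (row k 1%:M) (e s) = if k \in s then 0 else (-1) ^+ koszul_sign k s *: e (k |: s).
Proof. by have := lwedge_gl_act_monomial 1%:M k s; rewrite !gl_act1. Qed.

Lemma gl_act_monomialU g k s : k \notin s ->
  gl_act g (e (k |: s)) = (-1) ^+ koszul_sign k s *: lwedge (row k g) (gl_act g (e s)).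
Proof.
move=> ks; rewrite lwedge_gl_act_monomial (negPf ks) scalerA -expr2 sqrr_sign.
by rewrite scale1r.
Qed.

Lemma gl_act_lwedge_basis g k u :
  gl_act g (lwedge (row k 1%:M) u) = lwedge (row k g) (gl_act g u).
Proof.
rewrite {1}(ext_decomp u) (gl_act_sum g u) !linear_sum; apply: eq_bigr => s _.
rewrite !linearZ /= lwedge_monomial lwedge_gl_act_monomial; congr (_ *: _).
by case: ifP => _; rewrite ?linear0 ?linearZ.
Qed.

Lemma row_sum_basis x : x = \sum_k x 0 k *: row k 1%:M.
Proof. by rewrite -mulmx_sum_row mulmx1. Qed.

Lemma gl_act_lwedge g x u : gl_act g (lwedge x u) = lwedge (x *m g) (gl_act g u).
Proof.
rewrite {1}(row_sum_basis x) lwedge_suml linear_sum mulmx_sum_row lwedge_suml.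
by apply: eq_bigr => k _; rewrite linearZ /= gl_act_lwedge_basis.
Qed.

Lemma gl_actM g h u : gl_act (g *m h) u = gl_act h (gl_act g u).
Proof.
rewrite (gl_act_sum g) linear_sum gl_act_sum; apply: eq_bigr => s _.
rewrite linearZ /= !gl_act_monomial; congr (_ *: _); elim: (enum s) => [|k l IHl].
  rewrite /lprod /= gl_act_monomial.
  by rewrite (_ : enum set0 = [::]) //; apply/eqP; rewrite -size_eq0 -cardE cards0.
by rewrite /lprod /= -!/(lprod _ _) IHl gl_act_lwedge row_mul.
Qed.

Definition replace_row g j (x : 'rV[K]_n) : 'M[K]_n :=
  \matrix_k if k == j then x else row k g.

Lemma row_replace_row g j x k : row k (replace_row g j x) = if k == j then x else row k g.
Proof. by rewrite rowK. Qed.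

(** The image of a monomial is linear in row j.  This computes both the
    degeneration that realizes a combinatorial shift and the elementary matrices
    that force shiftedness. *)
Lemma gl_act_replace_row g i j (a b : K) s : i != j ->
  gl_act (replace_row g j (a *: row i g + b *: row j g)) (e s) =
    if j \notin s then gl_act g (e s) else
    b *: gl_act g (e s) +
    (if i \in s then 0 else
     (a * (-1) ^+ (koszul_sign j (s :\ j) + koszul_sign i (s :\ j)))
       *: gl_act g (e (i |: (s :\ j)))).
Proof.
move=> ij; set h := replace_row _ _ _.
have hg k : k != j -> row k h = row k g by rewrite row_replace_row => /negPf->.
have hj : row j h = a *: row i g + b *: row j g by rewrite row_replace_row eqxx.
case: ifP => [js|/negbFE js].
  by apply: eq_gl_act_monomial => k ks; apply: hg; apply: contraNneq js => <-.
have jN : j \notin s :\ j by rewrite !inE eqxx.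
have E : gl_act h (e (s :\ j)) = gl_act g (e (s :\ j)).
  by apply: eq_gl_act_monomial => k; rewrite !inE => /andP[kj _]; apply: hg.
rewrite -{1}(setD1K js) gl_act_monomialU // E hj lwedge_linearl.
rewrite -[b *: row j g]addr0 lwedge_linearl.
have -> : lwedge 0 (gl_act g (e (s :\ j))) = 0.
  by apply/ffunP => r; rewrite lwedgeE ffunE big1 // => k _; rewrite mxE mulr0 mul0r.
rewrite addr0 addrC scalerDr; congr (_ + _).
  by rewrite -[in RHS](setD1K js) gl_act_monomialU // !scalerA mulrC.
rewrite lwedge_gl_act_monomial !inE ij /=.
case: ifP => _; rewrite ?scaler0 // !scalerA exprD; congr (_ *: _).
by rewrite mulrA; congr (_ * _); apply: mulrC.
Qed.

End LeftWedge.

(** * The reverse lexicographic order *)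

Section RevLex.
Local Open Scope ring_scope.
Variable n : nat.
Implicit Types (s t r : {set 'I_n}) (k l m : 'I_n).

Lemma lt_revP t s :
  reflect (exists m, [/\ m \in t, m \notin s & forall l, (m < l)%N -> (l \in t) = (l \in s)])
          (lt_rev t s).
Proof.
apply: (iffP existsP) => -[m].
  case/and3P=> mt ms /forallP P; exists m; split=> // l ml.
  by apply/eqP; apply: implyP (P l) ml.
case=> mt ms P; exists m; rewrite mt ms; apply/forallP => l.
by apply/implyP => /P->.
Qed.

Lemma lt_rev_total s t : s != t -> lt_rev s t || lt_rev t s.
Proof.
move=> st; pose P l := (l \in s) != (l \in t).
have [l0 Pl0] : exists l, P l.
  apply/existsP; apply: contraR st => /existsPn N; apply/eqP/setP => l.
  by apply/eqP; rewrite -[_ == _]negbK N.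
case: (@arg_maxnP _ l0 P (fun l => l : nat) Pl0) => m Pm mmax.
have eq_st l : (m < l)%N -> (l \in s) = (l \in t).
  move=> ml; apply/eqP; apply: contraTT ml => Pl; rewrite -leqNgt; exact: mmax.
move: Pm; rewrite /P; case: (boolP (m \in s)) => ms; case: (boolP (m \in t)) => mt // _.
  by apply/orP; left; apply/lt_revP; exists m; split.
by apply/orP; right; apply/lt_revP; exists m; split=> // l /eq_st.
Qed.

(** The binary number with digits s: it is larger when the monomial is
    smaller for [lt_rev]. *)
Definition rev_weight s : nat := \sum_(l in s) 2 ^ l.

Lemma lt_rev_weight t s : lt_rev t s -> (rev_weight s < rev_weight t)%N.
Proof.
case/lt_revP=> m [mt ms P]; rewrite /rev_weight.
rewrite (bigID (fun l : 'I_n => (m < l)%N)) /= [X in (_ < X)%N](bigID (fun l : 'I_n => (m < l)%N)) /=.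
have -> : (\sum_(l in s | (m < l)%N) 2 ^ l = \sum_(l in t | (m < l)%N) 2 ^ l)%N.
  by apply: eq_bigl => l; case: ltnP => [/P->|]; rewrite ?andbF.
rewrite ltn_add2l; apply: (@leq_trans (2 ^ m)); last first.
  by rewrite (bigD1 m) /= ?leq_addr // mt ltnn.
apply: (@leq_ltn_trans (\sum_(l < m) 2 ^ l)%N); last first.
  by rewrite -[X in (_ < X)%N](@prednK (2 ^ m)) ?expn_gt0 // predn_exp mul1n.
rewrite (big_ord_widen n (fun l : nat => 2 ^ l)%N (ltnW (ltn_ord m))).
rewrite big_mkcond [X in (_ <= X)%N]big_mkcond; apply: leq_sum => l _ /=.
case: ifP => //= /andP[ls]; rewrite -leqNgt leq_eqVlt => /orP[/eqP/val_inj lm|->//].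
by rewrite -lm ls in ms.
Qed.

Lemma lt_rev_irr s : lt_rev s s = false.
Proof. apply/negbTE/negP => ss; by have := lt_rev_weight ss; rewrite ltnn. Qed.

Lemma lt_rev_asym s t : lt_rev s t -> lt_rev t s -> False.
Proof. by move=> /lt_rev_weight st /lt_rev_weight /(ltn_trans st); rewrite ltnn. Qed.

Lemma lt_rev_trans s t r : lt_rev s t -> lt_rev t r -> lt_rev s r.
Proof.
move=> /lt_rev_weight st /lt_rev_weight tr.
have sr : s != r by apply/eqP => E; move: (ltn_trans tr st); rewrite E ltnn.
case/orP: (lt_rev_total sr) => // /lt_rev_weight rs.
by have := ltn_trans tr (ltn_trans st rs); rewrite ltnn.
Qed.

Lemma lt_rev_max (P : pred {set 'I_n}) s0 : P s0 ->
  exists s, [/\ P s, forall t, P t -> t != s -> lt_rev t s & s = s0 \/ lt_rev s0 s].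
Proof.
move=> Ps0; case: (@arg_minnP _ s0 P rev_weight Ps0) => s Ps smin.
have max t : P t -> t != s -> lt_rev t s.
  move=> Pt ts; case/orP: (lt_rev_total ts) => // /lt_rev_weight.
  by rewrite ltnNge smin.
exists s; split=> //; have [->|ss0] := eqVneq s s0; first by left.
by right; apply: max; rewrite // eq_sym.
Qed.

Lemma lt_rev_setU1 k s t : k \in t -> k \notin s -> lt_rev (t :\ k) s -> lt_rev t (k |: s).
Proof.
move=> kt ks /lt_revP[m []]; rewrite !inE => /andP[mk mt] ms P.
apply/lt_revP; exists m; rewrite !inE (negPf mk) mt; split=> // l /P.
by rewrite !inE; case: eqP => [->|] //=.
Qed.

(** Exchanging i for j in both sets leaves their symmetric difference unchanged. *)
Lemma lt_rev_exchange (i j : 'I_n) s t : i \in s -> i \in t -> j \notin s -> j \notin t ->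
  lt_rev s t -> lt_rev (j |: (s :\ i)) (j |: (t :\ i)).
Proof.
move=> si ti sj tj /lt_revP[m [ms mt P]]; apply/lt_revP; exists m; split.
- rewrite !inE ms andbT; case: (eqVneq m i) => [E|_]; last by rewrite orbT.
  by rewrite E ti in mt.
- rewrite !inE (negPf mt) andbF orbF; apply: contraNneq sj => <-.
  exact: ms.
- by move=> l /P; rewrite !inE => ->.
Qed.

Definition rev_upper (A : {set {set 'I_n}}) :=
  forall s t, s \in A -> lt_rev s t -> t \in A.

(** Locked so that membership rewriting does not unfold it. *)
Definition below (k : nat) : {set {set 'I_n}} :=
  locked [set s : {set 'I_n} | [forall l in s, (l < k)%N]].

Lemma belowP (k : nat) s : reflect {in s, forall l : 'I_n, (l < k)%N} (s \in below k).
Proof. by rewrite /below -lock inE; apply: forall_inP. Qed.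

Lemma below_upper (k : nat) : rev_upper (below k).
Proof.
move=> s t /belowP sk /lt_revP[m [ms mt P]]; apply/belowP => l lt.
have [/P ls|lm] := ltnP m l; first by rewrite sk // ls.
by apply: leq_ltn_trans lm _; apply: sk.
Qed.

End RevLex.

Section Triangular.
Local Open Scope ring_scope.
Variables (K : fieldType) (n : nat).

(** Combinations of the rows with pairwise distinct leading entries are
    linearly independent. *)
Lemma frank_triangular (T : finType) (f : T -> {set 'I_n} -> K) (C : {set {set 'I_n}}) :
  (forall r, r \in C -> exists c : T -> K,
     \sum_a c a * f a r != 0 /\
     forall q, q \in C -> lt_rev r q -> \sum_a c a * f a q = 0) ->
  (#|C| <= frank f)%N.
Proof.
move=> H; have [c cP] := fin_all_exists (fun r : {r | r \in C} => H _ (svalP r)).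
pose f1 (r : {r | r \in C}) b := \sum_a c r a * f a b.
rewrite -[#|C|](card_sig (mem C)); apply: (@leq_trans (frank f1)); last first.
  exact: (frank_comb (c := c)).
apply: frank_indep => d df r0; apply/eqP; apply/negPn/negP => d0.
case: (@arg_minnP _ r0 (fun r => d r != 0) (fun r => rev_weight (sval r)) d0) => r dr rmin.
have := df (sval r); rewrite (bigD1 r) //= big1 ?addr0; last first.
  move=> q qr; have [->|dq] := eqVneq (d q) 0; first by rewrite mul0r.
  have sqr : sval q != sval r by [].
  have lt_qr : lt_rev (sval q) (sval r).
    case/orP: (lt_rev_total sqr) => // /lt_rev_weight.
    by rewrite ltnNge (rmin q dq).
  by rewrite /f1 (proj2 (cP q) _ (svalP r) lt_qr) mulr0.
by move/eqP; rewrite mulf_eq0 (negPf dr) (negPf (proj1 (cP r))).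
Qed.

Lemma frank_rows (T T' : finType) (f : T -> T' -> K) (X : {set T}) :
  (forall a b, a \notin X -> f a b = 0) -> (frank f <= #|X|)%N.
Proof.
move=> fX; pose f1 (x : {x | x \in X}) b := f (sval x) b.
apply: (@leq_trans (frank f1)); last first.
  by rewrite /frank (leq_trans (rank_leq_row _)) // (card_sig (mem X)).
apply: (frank_comb (c := fun a (x : {x | x \in X}) => (a == sval x)%:R)) => a b.
have [aX|aX] := boolP (a \in X); last first.
  rewrite fX // big1 // => x _; case: eqP => [E|]; last by rewrite mul0r.
  by rewrite E (svalP x) in aX.
rewrite (bigD1 (exist _ a aX)) //= eqxx mul1r big1 ?addr0 // => x xa.
case: eqP => [E|]; last by rewrite mul0r.
by case/eqP: xa; apply: val_inj.
Qed.

End Triangular.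

(** * Initial monomials as ranks of projections *)

Section Gin.
Local Open Scope ring_scope.
Variables (K : fieldType) (n : nat).
Implicit Types (s t r : {set 'I_n}) (k l : 'I_n) (u v w : ext K n).
Implicit Types (g h : 'M[K]_n) (D A : {set {set 'I_n}}).
Local Notation e := (@ext_monomial K n).

Lemma sum_neq0 (V : nmodType) (I : Type) (r : seq I) (P : pred I) (F : I -> V) :
  \sum_(i <- r | P i) F i <> 0 -> exists2 i, P i & F i <> 0.
Proof.
elim/big_rec: _ => [//|i x Pi IH]; have [->|/eqP Fi _] := eqVneq (F i) 0.
  by rewrite add0r.
by exists i.
Qed.

Lemma wedge_neq0 u v r : wedge u v r <> 0 ->
  exists2 s : {set 'I_n}, s \subset r & u s <> 0 /\ v (r :\: s) <> 0.
Proof.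
rewrite ffunE => /sum_neq0[s sr uv]; exists s => //; split=> z; apply: uv.
  by rewrite z mulr0 mul0r.
by rewrite z mulr0.
Qed.

Lemma ext_ideal_gen_support (G : ext K n -> Prop) (P : {set 'I_n} -> Prop) u t :
  (forall v, G v -> exists2 s, P s & v = e s) ->
  ext_ideal_gen G u -> u t <> 0 -> exists2 s, P s & s \subset t.
Proof.
move=> GP [c cG ->]; rewrite sum_ffunE big_seq => /sum_neq0[p /cG/GP[s Ps ->]].
case/wedge_neq0=> r rt [/wedge_neq0[q qr [_ sq]] _]; exists s => //.
move: sq; rewrite ffunE; case: eqP => // <- _.
by apply: subset_trans (subsetDl _ _) rt.
Qed.

Lemma wedge_e0l u : wedge (e set0) u = u.
Proof.
apply/ffunP => r; rewrite ffunE (bigD1 set0) ?sub0set //= big1 ?addr0.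
  rewrite setD0 ffunE eqxx mulr1 (_ : ext_sign set0 r = 0%N) ?mul1r //.
  by apply: eq_card0 => p; rewrite !inE.
by move=> s /andP[_ s0]; rewrite ffunE (negPf s0) mulr0 mul0r.
Qed.

Lemma wedge_e0r u : wedge u (e set0) = u.
Proof.
apply/ffunP => r; rewrite ffunE (bigD1 r) //= big1 ?addr0.
  rewrite setDv ffunE eqxx mulr1 (_ : ext_sign r set0 = 0%N) ?mul1r //.
  by apply: eq_card0 => p; rewrite !inE andbF.
move=> s /andP[sr ne]; rewrite ffunE setD_eq0; case: (boolP (r \subset s)) => rs.
  by case/eqP: ne; apply/eqP; rewrite eqEsubset sr.
by rewrite mulr0.
Qed.

Lemma extZE (a : K) u s : (a *: u) s = a * u s.
Proof. by rewrite ffunE. Qed.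

Lemma wedgeZl a u v : wedge (a *: u) v = a *: wedge u v.
Proof.
apply/ffunP => r; rewrite extZE !ffunE mulr_sumr; apply: eq_bigr => s _.
by rewrite extZE mulrCA !mulrA.
Qed.

Lemma ext_ideal_gen_base (G : ext K n -> Prop) u : G u -> ext_ideal_gen G u.
Proof.
move=> Gu; exists [:: (e set0, u, e set0)] => [p|]; first by rewrite inE => /eqP->.
by rewrite big_seq1 /= wedge_e0l wedge_e0r.
Qed.

(** The ideal is spanned by monomials because supersets of nonfaces are
    nonfaces. *)
Lemma exterior_face_idealP D u : simplicial_complex D ->
  exterior_face_ideal D u <-> (forall s, u s <> 0 -> s \notin D).
Proof.
move=> [_ Dcl]; split=> [uD s us|uD].
  have [|r rD rs] := ext_ideal_gen_support (P := fun s => s \notin D) _ uD us.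
    by move=> v [r rD ->]; exists r.
  by apply: contra rD => /Dcl; apply.
pose c s : ext K n * ext K n * ext K n := (u s *: e set0, e s, e set0).
exists [seq c s | s <- enum [set s | u s != 0]] => [p|].
  case/mapP=> s; rewrite mem_enum inE => /eqP/uD sD ->; exists s => //.
rewrite big_map big_enum_cond /= {1}(ext_decomp u) [RHS]big_mkcond; apply: eq_bigr => s _.
rewrite andbT inE; case: eqP => [->|_] /=; first by rewrite scale0r.
by rewrite wedge_e0r wedgeZl wedge_e0l.
Qed.

Lemma gl_act_monomial_card g s t : gl_act g (e s) t <> 0 -> #|t| = #|s|.
Proof.
rewrite gl_act_monomial [#|s|]cardE; elim: (enum s) t => [|k l IHl] t.
  by rewrite /lprod /= ffunE; case: eqP => [->|//]; rewrite cards0.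
rewrite /lprod /= -/(lprod g l) lwedgeE => /sum_neq0[i it H].
rewrite (cardsD1 i) it (IHl (t :\ i)) // => z; apply: H.
by rewrite z mulr0.
Qed.

Lemma gl_act_coef g u t : gl_act g u t = \sum_s u s * gl_act g (e s) t.
Proof. by rewrite gl_act_sum sum_ffunE; apply: eq_bigr => s _; rewrite ffunE. Qed.

Definition nonface_vector D (d : nat) u := forall s, u s <> 0 -> s \notin D /\ #|s| = d.

Lemma gl_act_card g D d u t : nonface_vector D d u -> gl_act g u t <> 0 -> #|t| = d.
Proof.
move=> uD; rewrite gl_act_coef => /sum_neq0[s _ us].
have [|_ <-] := uD s; first by move=> z; apply: us; rewrite z mul0r.
by apply: (@gl_act_monomial_card g) => z; apply: us; rewrite z mulr0.
Qed.

(** In terms of preimages: the vectors [gl_act g u] with u a nonface vector are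
    the homogeneous elements of the transformed face ideal. *)
Definition initial_in g D s :=
  exists2 u, nonface_vector D #|s| u & is_initial_monomial (gl_act g u) s.

(** The unit vector e_k is the image under g of row k of the inverse of g, so
    left multiplication by e_k stays in the transformed ideal; it shifts every
    monomial compatibly with the order. *)
Lemma initial_inU g D k s : g \in unitmx -> simplicial_complex D ->
  k \notin s -> initial_in g D s -> initial_in g D (k |: s).
Proof.
move=> gU [_ Dcl] ks [u uD [us umax]].
exists (lwedge (row k (invmx g)) u).
  move=> t; rewrite lwedgeE => /sum_neq0[l lt H].
  have [|tD tc] := uD (t :\ l); first by move=> z; apply: H; rewrite z mulr0.
  split; first by apply: contra tD => /Dcl; apply; apply: subsetDl.
  by rewrite (cardsD1 l) lt tc cardsU1 ks.
have E t : lwedge (row k 1%:M) (gl_act g u) t =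
    if k \in t then (-1) ^+ koszul_sign k t * gl_act g u (t :\ k) else 0.
  rewrite lwedgeE big_mkcond (bigD1 k) //= big1 ?addr0 => [|l lk].
    by rewrite !mxE eqxx mulr1.
  by rewrite !mxE eq_sym (negPf lk) mulr0 mul0r if_same.
rewrite gl_act_lwedge -row_mul mulVmx //; split.
  rewrite E setU11 setU1K //; apply/eqP; rewrite mulf_neq0 ?signr_eq0 //.
  exact/eqP.
move=> t; rewrite E; case: ifP => // kt H ts.
apply: lt_rev_setU1 => //; apply: umax; first by move=> z; apply: H; rewrite z mulr0.
by move=> E1; apply: ts; rewrite -E1 setD1K.
Qed.

Lemma initial_in_sup g D s t : g \in unitmx -> simplicial_complex D ->
  s \subset t -> initial_in g D s -> initial_in g D t.
Proof.
move=> gU DC; have [m] := ubnP #|t :\: s|; elim: m s => // m IHm s lt_m st sI.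
have [|/set0Pn[k kts]] := eqVneq (t :\: s) set0.
  move/eqP; rewrite setD_eq0 => ts.
  by rewrite (_ : t = s) //; apply/eqP; rewrite eqEsubset ts.
move: (kts); rewrite inE => /andP[ks kt].
apply: (IHm (k |: s)); last exact: initial_inU.
  by move: lt_m; rewrite (cardsD1 k) kts setDDl setUC.
by rewrite subUset sub1set kt.
Qed.

(** By [initial_in_sup] the initial monomials are closed under multiples, so
    the ideal they generate contains no other monomial. *)
Lemma initial_idealP g D s : g \in unitmx -> simplicial_complex D ->
  initial_ideal (gl_act_ideal g (exterior_face_ideal D)) (e s) <-> initial_in g D s.
Proof.
move=> gU DC; split=> [sI|[u uD us]]; last first.
  apply: ext_ideal_gen_base; exists s, (gl_act g u), #|s|; split=> //.
    by exists u => //; apply/exterior_face_idealP => // t /uD[].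
  by move=> t; apply: gl_act_card uD.
have [||t tI ts] := @ext_ideal_gen_support _ (initial_in g D) _ s _ sI.
- move=> _ [t [_ [d [[u uD ->] ud ut ->]]]]; exists t => //.
  have dt : #|t| = d by case: ut => /ud.
  exists [ffun r : {set 'I_n} => if #|r| == d then u r else 0].
    move=> r; rewrite ffunE dt; case: eqP => // rd ur; split=> //.
    by case: (exterior_face_idealP u DC) => H _; apply: H ur.
  rewrite (_ : gl_act g _ = gl_act g u) //; apply/ffunP => r.
  have [rd|rd] := eqVneq #|r| d.
    rewrite !gl_act_coef; apply: eq_bigr => q _; rewrite ffunE; case: eqP => // qd.
    have [->|/eqP/gl_act_monomial_card E] := eqVneq (gl_act g (e q) r) 0.
      by rewrite !mulr0.
    by case: qd; rewrite -E.
  transitivity (0 : K^o); last first.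
    by apply/esym; have [//|/eqP/ud/eqP] := eqVneq (gl_act g u r) 0; rewrite (negPf rd).
  rewrite gl_act_coef big1 // => q _; rewrite ffunE; case: eqP => [qd|]; last by rewrite mul0r.
  have [->|/eqP/gl_act_monomial_card E] := eqVneq (gl_act g (e q) r) 0.
    by rewrite mulr0.
  by rewrite E qd eqxx in rd.
- by rewrite ffunE eqxx; apply/eqP; rewrite oner_eq0.
exact: initial_in_sup ts tI.
Qed.

Definition nonfaces D (d : nat) A := [set s | [&& s \notin D, #|s| == d & s \in A]].

(** Rows and columns that are not selected are zeroed rather than removed, so
    that all these ranks concern families indexed by the same type. *)
Definition proj_rank D d A g : nat :=
  frank (K := K) (fun s t => if [&& s \notin D, #|s| == d & t \in A] then gl_act g (e s) t else 0).

Lemma frank_le_proj_rank (T : finType) (f : T -> {set 'I_n} -> K) D d A g :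
  (forall a, exists2 u, nonface_vector D d u &
     forall t, f a t = if t \in A then gl_act g u t else 0) ->
  (frank f <= proj_rank D d A g)%N.
Proof.
case/fin_all_exists2=> u uD fE; apply: (@frank_comb K _ _ _ _ _ (fun a s => u a s)) => a t.
rewrite fE; case: ifP => tA; last by rewrite big1 // => s _; rewrite !andbF mulr0.
rewrite gl_act_coef; apply: eq_bigr => s _; rewrite andbT.
have [->|/eqP/(uD a)[-> ->]] := eqVneq (u a s) 0; first by rewrite !mul0r.
by rewrite eqxx.
Qed.

(** Elements with distinct initial monomials in A stay independent after
    projection to A. *)
Lemma proj_rank_ge D d A g (X : {set {set 'I_n}}) :
  (forall s, s \in X -> [/\ s \in A, #|s| = d & initial_in g D s]) ->
  (#|X| <= proj_rank D d A g)%N.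
Proof.
move=> XP; apply: frank_triangular => r /XP[rA <- [u uD [ur umax]]].
have E q : q \in A -> \sum_a u a * (if [&& a \notin D, #|a| == #|r| & q \in A]
    then gl_act g (e a) q else 0) = gl_act g u q.
  move=> qA; rewrite gl_act_coef; apply: eq_bigr => a _; rewrite qA andbT.
  have [->|/eqP/uD[-> ->]] := eqVneq (u a) 0; first by rewrite !mul0r.
  by rewrite eqxx.
exists u; split; first by rewrite E //; apply/eqP.
move=> q /XP[qA _ _] rq; rewrite E //; apply/eqP/negPn/negP => /eqP uq.
have qr : q <> r by move=> qr; rewrite qr lt_rev_irr in rq.
exact: lt_rev_asym rq (umax q uq qr).
Qed.

(** A vector with nonzero projection to the upper set A has its initial monomial
    in A.  So it cannot vanish on all the initial monomials in A, and
    projecting further to those loses no rank. *)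
Lemma proj_rank_le D d A g (X : {set {set 'I_n}}) : rev_upper A ->
  (forall s, s \in A -> #|s| = d -> initial_in g D s -> s \in X) ->
  (proj_rank D d A g <= #|X|)%N.
Proof.
move=> upA XP.
pose f s t : K := if [&& s \notin D, #|s| == d & t \in A :&: X] then gl_act g (e s) t else 0.
apply: (@leq_trans (frank f)); last first.
  apply: frank_card => s t tX; rewrite /f; case: ifP => // /and3P[_ _].
  by rewrite inE (negPf tX) andbF.
apply: frank_kernel => c cf b.
pose u : ext K n := [ffun s => if (s \notin D) && (#|s| == d) then c s else 0].
have uD : nonface_vector D d u.
  by move=> s; rewrite ffunE; case: ifP => // /andP[-> /eqP].
have E (B : {set {set 'I_n}}) q : \sum_a c a * (if [&& a \notin D, #|a| == d & q \in B]
    then gl_act g (e a) q else 0) = if q \in B then gl_act g u q else 0.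
  case: ifP => qB; last by rewrite big1 // => a _; rewrite !andbF mulr0.
  rewrite gl_act_coef; apply: eq_bigr => a _; rewrite andbT ffunE.
  by case: ifP => _; rewrite ?mulr0 ?mul0r.
rewrite E; case: ifP => // bA; apply/eqP/negPn/negP => ub.
have [s [us smax bs]] := @lt_rev_max _ (fun s => gl_act g u s != 0) b ub.
have sA : s \in A by case: bs => [->//|/(upA _ _ bA)].
have sd : #|s| = d by apply: (gl_act_card uD (g := g)); apply/eqP.
have := cf s; rewrite E inE sA XP //; first by move/eqP; rewrite (negPf us).
exists u; first by rewrite sd.
split; first exact/eqP.
by move=> t /eqP ut /eqP ts; apply: smax.
Qed.

Lemma polyfun_gl_act (G : K -> 'M[K]_n) s t :
  (forall a b, polyfun (fun x => G x a b)) ->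
  polyfun (K := K) (fun x => gl_act (G x) (e s) t).
Proof.
move=> Gp; have [p pE] : polyfun (K := K) (fun x => lprod (G x) (enum s) t).
  elim: (enum s) t => [|k l IHl] t; first exact: polyfun_const.
  have [p pE] : polyfun (fun x => \sum_(i in t) (-1) ^+ koszul_sign i t * G x k i *
       lprod (G x) l (t :\ i)).
    apply: polyfun_sum => i; apply: polyfunM (IHl _).
    by apply: polyfunM (polyfun_const _) (Gp _ _).
  exists p => x; rewrite -pE /lprod /= lwedgeE; apply: eq_bigr => i _.
  by rewrite mxE.
by exists p => x; rewrite gl_act_monomial.
Qed.

Lemma polyfun_proj_row (G : K -> 'M[K]_n) (b : bool) s t :
  (forall a b, polyfun (fun x => G x a b)) ->
  polyfun (K := K) (fun x => if b then gl_act (G x) (e s) t else 0).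
Proof. by case: b => Gp; [apply: polyfun_gl_act | apply: polyfun_const]. Qed.

Section Generic.
Hypothesis Kinf : infinite_field K.
Variables D De : {set {set 'I_n}}.
Hypotheses (DC : simplicial_complex D) (DeC : simplicial_complex De).
Hypothesis De_gin : is_gin (exterior_face_ideal (K := K) D) (exterior_face_ideal De).

(** On the open set of the generic initial ideal the rank for an upper set A is
    the number of nonfaces of De in A.  Any matrix g lies on a line through a point
    of that open set, and a generic point of the line is again in the open set and has
    rank at least that of g. *)
Lemma gin_generic : exists g0,
  [/\ g0 \in unitmx, forall s, initial_in g0 D s <-> s \notin De
    & forall A d g, rev_upper A -> (proj_rank D d A g <= #|nonfaces De d A|)%N].
Proof.
have [U [[F UE] [g0 Ug0] Uin]] := De_gin.
have unitU g : U g -> g \in unitmx by move/UE => [].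
have inU g s : U g -> initial_in g D s <-> s \notin De.
  move=> Ug; rewrite -initial_idealP ?unitU // (Uin g Ug).
  split=> [/(exterior_face_idealP _ DeC)|sDe].
    by apply; rewrite ffunE eqxx; apply/eqP; rewrite oner_eq0.
  by apply: ext_ideal_gen_base; exists s.
exists g0; split=> [||A d g upA]; [exact: unitU|by move=> s; apply: inU|].
pose G x := g0 + x *: (g - g0).
have Gp a b : polyfun (fun x => G x a b).
  have [p pE] : polyfun (fun x => g0 a b + x * (g a b - g0 a b)).
    exact: polyfunD (polyfun_const (g0 a b)) (polyfunM (@polyfun_id K) (polyfun_const _)).
  by exists p => x; rewrite !mxE -pE.
have G0 : G 0 = g0 by rewrite /G scale0r addr0.
have G1 : G 1 = g by rewrite /G scale1r addrCA subrr addr0.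
have [_ [f Ff fg0]] := proj1 (UE g0) Ug0.
have [p1 p1E] : polyfun (fun x => f.@[fun q : 'I_(n * n) => mxvec (G x) ord0 q]).
  apply: polyfun_meval => q; case/mxvec_indexP: q => a b.
  by have [p pE] := Gp a b; exists p => x; rewrite mxvecE.
have [p2 p2E] := polyfun_det Gp.
have [p3 p3N p3P] := @frank_semicont K _ _ (fun x s t =>
  if [&& s \notin D, #|s| == d & t \in A] then gl_act (G x) (e s) t else 0) 1
  (fun s t => polyfun_proj_row _ s t Gp).
(* x = 0 lies in the open set; the rank condition p3 is calibrated at x = 1. *)
have p1N : p1 != 0.
  by apply/eqP => z; apply: fg0; rewrite -G0 p1E z horner0.
have p2N : p2 != 0.
  apply/eqP => z; have := unitU _ Ug0.
  by rewrite unitmxE -G0 p2E z horner0 unitr0.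
have [x] := @infinite_nonroot K (p1 * p2 * p3) Kinf (mulf_neq0 (mulf_neq0 p1N p2N) p3N).
rewrite !hornerM !mulf_eq0 !negb_or => /andP[/andP[x1 x2] x3].
have UG : U (G x).
  apply/UE; split; first by rewrite unitmxE p2E unitfE.
  by exists f => //; rewrite p1E; apply/eqP.
rewrite -G1; apply: leq_trans (p3P _ x3) _.
apply: proj_rank_le upA _ => s sA sd /(inU _ _ UG) sDe.
by rewrite inE sDe sd eqxx.
Qed.

End Generic.

End Gin.

(** * Combinatorial shifting of faces *)

Section ShiftCombinatorics.
Local Open Scope ring_scope.
Variable n : nat.
Implicit Types (s t r : {set 'I_n}) (i j : 'I_n) (D : {set {set 'I_n}}).

Lemma exchangeK i j s : i \in s -> j \notin s -> i |: ((j |: (s :\ i)) :\ j) = s.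
Proof.
move=> si sj; rewrite setU1K ?inE ?(negPf sj) ?andbF //; exact: setD1K.
Qed.

Lemma exchange_card i j s : i \in s -> j \notin s -> #|j |: (s :\ i)| = #|s|.
Proof. by move=> si sj; rewrite cardsU1 !inE (negPf sj) andbF (cardsD1 i s) si. Qed.

Lemma exchange_in i j s : i != j -> i \in s -> j \notin s ->
  (i \notin j |: (s :\ i)) /\ j \in j |: (s :\ i).
Proof. by move=> ij si sj; rewrite !inE !eqxx (negPf ij). Qed.

(** Shifting moves faces only within a pair of sets exchanged by i and j: it keeps
    the number of faces in the pair and gives a single one to the side of j. *)
Lemma mem_Shift i j D r : i != j ->
  (r \in Shift i j D) =
    if j \in r then
      if i \in r then r \in D else (r \in D) || (i |: (r :\ j) \in D)
    else if i \in r then (r \in D) && (j |: (r :\ i) \in D) else r \in D.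
Proof.
move=> ij; have ji : j != i by rewrite eq_sym.
have fixD s : s \in D -> shift_face i j D s = s -> s \in Shift i j D.
  by move=> sD E; rewrite -E; apply: imset_f.
apply/imsetP/idP => [[s sD ->]|].
  rewrite /shift_face; case: (boolP [&& i \in s, j \notin s & _]) => [/and3P[si sj tD]|].
    have [it jt] := exchange_in ij si sj.
    by rewrite jt (negPf it) exchangeK // sD orbT.
  case: (boolP (j \in s)) => sj; case: (boolP (i \in s)) => si; rewrite ?sD //=.
  by move/negPn->.
case: (boolP (j \in r)) => rj; case: (boolP (i \in r)) => ri.
- by move=> rD; exists r; rewrite // /shift_face rj andbF.
- have [rD _|rD /= tD] := boolP (r \in D).
    by exists r; rewrite // /shift_face (negPf ri).
  have [jt it] := exchange_in ji rj ri.
  by exists (i |: (r :\ j)) => //; rewrite /shift_face it jt exchangeK // rD.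
- by case/andP=> rD tD; exists r; rewrite // /shift_face tD !andbF.
- by move=> rD; exists r; rewrite // /shift_face (negPf ri).
Qed.

Lemma Shift_complex i j D : i != j ->
  simplicial_complex D -> simplicial_complex (Shift i j D).
Proof.
move=> ij [D1 Dcl]; split=> [k|s t].
  rewrite mem_Shift // !inE D1; case: eqP => [<-|_].
    by rewrite (negPf ij).
  case: eqP => [<-|//]; rewrite (_ : j |: _ = [set j]) ?D1 //.
  by apply/setP => l; rewrite !inE andNb orbF.
have ji : j != i by rewrite eq_sym.
rewrite !mem_Shift // => sD ts.
have tD : s \in D -> t \in D by move=> /Dcl; apply.
have mem k : k \notin s -> k \notin t by apply: contra; apply: subsetP.
have memt k : k \in t -> k \in s by apply: subsetP.
have piD k l : l |: (s :\ k) \in D -> l |: (t :\ k) \in D.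
  by move=> /Dcl; apply; rewrite setUS // setSD.
have noD k l : k \notin t -> l |: (s :\ k) \in D -> t \in D.
  move=> kt /Dcl; apply; apply/subsetP => m mt; rewrite !inE memt //.
  by rewrite andbT (_ : m != k) ?orbT //; apply: contraNneq kt => <-.
have fullD k l : k \in s -> s \in D -> k |: (t :\ l) \in D.
  move=> ks /Dcl; apply; apply/subsetP => m; rewrite !inE.
  by case/orP=> [/eqP->//|/andP[_ /memt]].
case: (boolP (j \in t)) => tj; case: (boolP (i \in t)) => ti.
- by move: sD; rewrite !memt //; apply: tD.
- move: sD; rewrite (memt _ tj); case: ifP => [si /tD->//|_ /orP[/tD->//|/piD->]].
  by rewrite orbT.
- move: sD; rewrite (memt _ ti); case: (boolP (j \in s)) => sj.
    by move=> sD; rewrite tD // fullD.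
  by case/andP=> /tD-> /piD.
- move: sD; case: ifP => sj; case: ifP => si.
  + exact: tD.
  + by case/orP => [/tD//|/noD]; apply.
  + by case/andP => /tD.
  + exact: tD.
Qed.

Lemma card_nonfaces_Shift i j D d : i != j ->
  #|nonfaces (Shift i j D) d setT| = #|nonfaces D d setT|.
Proof.
move=> ij; pose F D := [set s in D | #|s| == d].
have E D1 : (#|F D1| + #|nonfaces D1 d setT| = #|[set s : {set 'I_n} | #|s| == d]|)%N.
  rewrite -(cardsID D1 [set s : {set 'I_n} | #|s| == d]); congr (_ + _)%N.
    by apply: eq_card => s; rewrite !inE andbC.
  by apply: eq_card => s; rewrite !inE andbT.
suff FE : #|F (Shift i j D)| = #|F D|.
  by have := E (Shift i j D); rewrite FE -(E D) => /addnI.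
have cardS s : #|shift_face i j D s| = #|s|.
  by rewrite /shift_face; case: ifP => // /and3P[si sj _]; apply: exchange_card.
rewrite -(@card_in_imset _ _ (shift_face i j D) (mem (F D))).
  apply: eq_card => r; rewrite !inE; apply/andP/imsetP => [[/imsetP[s sD ->] rd]|[s + ->]].
    by exists s; rewrite // !inE sD -cardS.
  by rewrite !inE => /andP[sD sd]; rewrite imset_f // cardS.
move=> s t; rewrite !inE => /andP[sD _] /andP[tD _]; rewrite /shift_face.
case: ifP => [/and3P[si sj s'D]|_]; case: ifP => [/and3P[ti tj t'D]|_] // E1.
- by rewrite -(exchangeK si sj) E1 exchangeK.
- by rewrite E1 tD in s'D.
- by rewrite -E1 sD in t'D.
Qed.

End ShiftCombinatorics.

(** * Ranks under shifting, and shiftedness of the generic initial ideal *)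

Section ShiftRank.
Local Open Scope ring_scope.
Variables (K : fieldType) (n : nat).
Implicit Types (s t r : {set 'I_n}) (k l i j : 'I_n) (u v w : ext K n).
Implicit Types (g h : 'M[K]_n) (D A : {set {set 'I_n}}).
Local Notation e := (@ext_monomial K n).

Lemma polyfun_replace_row g i j (a b : K -> K) p q :
  polyfun a -> polyfun b ->
  polyfun (fun x => replace_row g j (a x *: row i g + b x *: row j g) p q).
Proof.
move=> pa pb; have [f fE] : polyfun (fun x => if p == j then a x * g i q + b x * g j q else g p q).
  case: (p == j); last exact: polyfun_const.
  by apply: polyfunD; apply: polyfunM (polyfun_const _).
by exists f => x; rewrite -fE mxE; case: eqP => _; rewrite !mxE.
Qed.

Section InfiniteField.
Hypothesis Kinf : infinite_field K.

Lemma infinite_nonroot_neq0 (p : {poly K}) : p != 0 -> exists2 x, x != 0 & p.[x] != 0.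
Proof.
move=> p0; have [x] := @infinite_nonroot K (p * 'X) Kinf (mulf_neq0 p0 (negbT (polyX_eq0 K))).
by rewrite hornerM hornerX mulf_eq0 negb_or => /andP[px x0]; exists x.
Qed.

(** Let h_t be g with row j replaced by row i + t row j.  For every nonface s of
    the shifted complex the image of e_s + t q_s under g is, for t <> 0, in the
    image under h_t of the nonface vectors of D, and for t = 0 it is the image of e_s. *)
Lemma proj_rank_Shift i j D d A g : i != j ->
  exists h, (proj_rank (Shift i j D) d A g <= proj_rank D d A h)%N.
Proof.
move=> ij; have ji : j != i by rewrite eq_sym.
pose sg s : K := (-1) ^+ (koszul_sign j (s :\ j) + koszul_sign i (s :\ j)).
have sg2 s : sg s * sg s = 1 by rewrite -expr2 sqrr_sign.
pose h x := replace_row g j (1 *: row i g + x *: row j g).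
have hE x s : gl_act (h x) (e s) = if j \notin s then gl_act g (e s) else
    x *: gl_act g (e s) +
    (if i \in s then 0 else sg s *: gl_act g (e (i |: (s :\ j)))).
  by rewrite gl_act_replace_row // mul1r.
pose q s := if [&& i \in s, j \notin s & s \in D] then
  sg (j |: (s :\ i)) *: e (j |: (s :\ i)) else 0.
pose f x s t : K := if [&& s \notin Shift i j D, #|s| == d & t \in A]
  then gl_act g (e s + x *: q s) t else 0.
have fp s t : polyfun (fun x => f x s t).
  have [p pE] : polyfun (K := K) (fun x => if [&& s \notin Shift i j D, #|s| == d & t \in A]
      then gl_act g (e s) t + x * gl_act g (q s) t else 0).
    case: [&& _, _ & _]; last exact: polyfun_const.
    exact: polyfunD (@polyfun_const K (gl_act g (e s) t))
      (polyfunM (@polyfun_id K) (@polyfun_const K (gl_act g (q s) t))).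
  by exists p => x; rewrite -pE /f linearD linearZ !ffunE.
have [p p0 pP] := frank_semicont 0 fp.
have [x x0 px] := infinite_nonroot_neq0 p0.
exists (h x); apply: leq_trans (leq_trans (pP x px) _).
  apply: (@frank_comb K _ _ _ _ _ (fun a b => (a == b)%:R)) => s t.
  rewrite (bigD1 s) //= eqxx mul1r big1 ?addr0 => [|b bs].
    by rewrite /f scale0r addr0.
  by rewrite eq_sym (negPf bs) mul0r.
apply: frank_le_proj_rank => s.
have [|] := boolP ((s \notin Shift i j D) && (#|s| == d)); last first.
  move=> N; exists 0 => [t|t]; first by rewrite ffunE.
  by rewrite linear0 /f andbA (negPf N) /= ffunE if_same.
case/andP=> sN /eqP sd.
suff [u uD uE] : exists2 u, nonface_vector D d u & gl_act (h x) u = gl_act g (e s + x *: q s).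
  by exists u => // t; rewrite /f sN sd eqxx /= uE.
have eD r : r \notin D -> #|r| = d -> nonface_vector D d (e r).
  by move=> rD rd t; rewrite ffunE; case: eqP => // ->.
have ZD (a : K) u : nonface_vector D d u -> nonface_vector D d (a *: u).
  by move=> uD t; rewrite ffunE => N; apply: uD => z; apply: N; rewrite z scaler0.
have addD u v : nonface_vector D d u -> nonface_vector D d v -> nonface_vector D d (u + v).
  move=> uD vD t; rewrite ffunE; have [->|/eqP/uD//] := eqVneq (u t) 0.
  by rewrite add0r; apply: vD.
move: sN; rewrite mem_Shift //; case: (boolP (j \in s)) => sj; case: (boolP (i \in s)) => si.
- move=> sD; exists (x^-1 *: e s); first exact/ZD/eD.
  rewrite linearZ /= hE sj si addr0 scalerA mulVf // scale1r.
  by rewrite /q si sj scaler0 addr0.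
- rewrite negb_or => /andP[sD tD]; have [jt it] := exchange_in ji sj si.
  exists (x^-1 *: (e s + (- sg s) *: e (i |: (s :\ j)))).
    by apply/ZD/addD; [apply: eD|apply/ZD/eD => //; rewrite exchange_card].
  rewrite linearZ linearD linearZ /= !hE sj (negPf si) jt scaleNr addrK.
  by rewrite scalerA mulVf // scale1r /q (negPf si) scaler0 addr0.
- case: (boolP (s \in D)) => [sD tD|sD _]; last first.
    exists (e s); first exact: eD.
    by rewrite hE sj /q (negPf sD) !andbF scaler0 addr0.
  have [it jt] := exchange_in ij si sj.
  exists (sg (j |: (s :\ i)) *: e (j |: (s :\ i))).
    by apply/ZD/eD; rewrite ?exchange_card.
  rewrite linearZ /= hE jt (negPf it) exchangeK // scalerDr !scalerA sg2 scale1r.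
  by rewrite /q si sj sD linearD !linearZ /= addrC scalerA [x * _]mulrC.
- move=> sD; exists (e s); first exact: eD.
  by rewrite hE sj /q (negPf si) scaler0 addr0.
Qed.

Lemma proj_rank_combinatorial D (ij : seq ('I_n * 'I_n)) d A g :
  all (fun p : 'I_n * 'I_n => (p.1 < p.2)%N) ij ->
  exists h, (proj_rank (foldl (fun D' (p : 'I_n * 'I_n) => Shift p.1 p.2 D') D ij) d A g
              <= proj_rank D d A h)%N.
Proof.
elim: ij D => [|p ij IH] D /=; first by exists g.
case/andP=> lt_p /(IH (Shift p.1 p.2 D))[h hP].
have ne_p : p.1 != p.2 by apply: contraTneq lt_p => ->; rewrite ltnn.
have [h' h'P] := proj_rank_Shift D d A h ne_p.
by exists h'; apply: leq_trans hP h'P.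
Qed.

Section GinOfComplex.
Variables D De : {set {set 'I_n}}.
Hypotheses (DC : simplicial_complex D) (DeC : simplicial_complex De).
Hypothesis De_gin : is_gin (exterior_face_ideal (K := K) D) (exterior_face_ideal De).

(** Suppose that t is a face and that s, obtained from t by exchanging i for a
    larger j, is not.  Then e_s is the initial monomial of some element w of the
    generic ideal.  The substitution e_j |-> e_j + x e_i sends w to w + x Dw, where
    Dw collects the terms of w with e_j replaced by e_i.  On the upper set of the
    monomials not smaller than e_t, w vanishes while Dw has initial monomial e_t,
    which is not initial in the generic ideal.  So for general x the transformed
    ideal has larger rank on this upper set than the generic one. *)
Lemma gin_shifted : shifted De.
Proof.
have [g0 [g0U inP rankP]] := gin_generic Kinf DC DeC De_gin.
move=> t i j tDe ti ij tj; apply/negPn/negP => sDe.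
have neij : i != j by apply: contraTneq ij => ->; rewrite ltnn.
have neji : j != i by rewrite eq_sym.
set s := j |: (t :\ i) in sDe.
have [si sj] : i \notin s /\ j \in s by apply: exchange_in.
have ts : i |: (s :\ j) = t by apply: exchangeK.
pose d := #|t|.
have sd : #|s| = d by apply: exchange_card.
have [u uD [us umax]] := proj2 (inP s) sDe.
rewrite sd in uD; pose w := gl_act g0 u.
have w_gt r : lt_rev s r -> w r = 0.
  move=> sr; apply/eqP/negPn/negP => /eqP wr.
  have rs : r <> s by move=> E; rewrite E lt_rev_irr in sr.
  exact: lt_rev_asym sr (umax r wr rs).
pose A := [set r | (r == t) || lt_rev t r].
have upA : rev_upper A.
  move=> r r'; rewrite !inE => /predU1P[->->|tr /(lt_rev_trans tr)->]; by rewrite orbT.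
have lt_st : lt_rev s t.
  apply/lt_revP; exists j; split=> // l jl; rewrite !inE.
  have [ne_lj ne_li] : l != j /\ l != i.
    by split; apply: contraTneq jl => ->; rewrite ?ltnn // -leqNgt ltnW.
  by rewrite (negPf ne_lj) ne_li.
have wA r : r \in A -> w r = 0.
  by rewrite inE => /predU1P[->|/(lt_rev_trans lt_st)]; apply: w_gt.
pose sg r : K := (-1) ^+ (koszul_sign j (r :\ j) + koszul_sign i (r :\ j)).
pose Dw r : K := if (i \in r) && (j \notin r) then
  sg (j |: (r :\ i)) * w (j |: (r :\ i)) else 0.
have Dw0 r : lt_rev t r -> Dw r = 0.
  rewrite /Dw; case: ifP => // /andP[ri rj] tr.
  by rewrite w_gt ?mulr0 //; apply: lt_rev_exchange.
have DwN : Dw t != 0.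
  rewrite /Dw ti tj mulf_neq0 ?signr_eq0 //; exact/eqP.
pose B x : 'M[K]_n := replace_row 1%:M j (x *: row i 1%:M + 1 *: row j 1%:M).
have BE x r : gl_act (B x) w r = w r + x * Dw r.
  rewrite gl_act_coef; transitivity (\sum_q (w q * (r == q)%:R +
      w q * (if (j \in q) && (i \notin q) then x * sg q * (r == i |: (q :\ j))%:R else 0))).
    apply: eq_bigr => q _; rewrite gl_act_replace_row // !gl_act1 -mulrDr.
    case: (j \in q); last by rewrite /= ffunE addr0.
    case: (i \in q); rewrite /= scale1r ?addr0; first by rewrite ffunE.
    by rewrite !ffunE.
  rewrite big_split /=; congr (_ + _).
    rewrite (bigD1 r) //= eqxx mulr1 big1 ?addr0 // => q /negPf rq.
    by rewrite eq_sym rq mulr0.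
  rewrite /Dw; case: ifP => [/andP[ri rj]|N].
    have [ri' rj'] := exchange_in neij ri rj.
    rewrite (bigD1 (j |: (r :\ i))) //= rj' ri' exchangeK // eqxx mulr1.
    rewrite big1 ?addr0; first by rewrite mulrC -mulrA.
    move=> q qr; case: ifP => [/andP[qj qi]|]; last by rewrite mulr0.
    case: eqP => [E|]; last by rewrite !mulr0.
    by case/eqP: qr; rewrite E exchangeK.
  rewrite mulr0 big1 // => q _; case: ifP => [/andP[qj qi]|]; last by rewrite mulr0.
  case: eqP => [E|]; last by rewrite !mulr0.
  have [rj ri] := exchange_in neji qj qi.
  by rewrite E ri rj in N.
(* For x <> 0 the row None is x^-1 times the image of u under g0 *m B x, because
   w vanishes on A. *)
pose f x (o : option {set 'I_n}) r : K := if o is Some a then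
    (if [&& a \notin D, #|a| == d & r \in A] then gl_act (g0 *m B x) (e a) r else 0)
  else if r \in A then Dw r else 0.
have fp o r : polyfun (fun x => f x o r).
  case: o => [a|]; last exact: polyfun_const.
  apply: polyfun_proj_row => p q.
  have [h hE] : polyfun (fun x => \sum_l g0 p l * B x l q).
    apply: polyfun_sum => l; apply: polyfunM (polyfun_const _) _.
    by apply: polyfun_replace_row; [apply: polyfun_id|apply: polyfun_const].
  by exists h => x; rewrite -hE mxE.
have [p p0 pP] := frank_semicont 0 fp.
have [x x0 px] := infinite_nonroot_neq0 p0.
have sum_option (F : option {set 'I_n} -> K) :
    \sum_o F o = F None + \sum_a F (Some a).
  rewrite (bigD1 None) //= (reindex_omap Some id) => [|[]//].
  by congr (_ + _); apply: eq_bigl => a; rewrite eqxx.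
have B0 : g0 *m B 0 = g0.
  rewrite (_ : B 0 = 1%:M) ?mulmx1 //; apply/row_matrixP => k.
  by rewrite row_replace_row scale0r scale1r add0r; case: eqP => // ->.
have tC : t \notin nonfaces De d A by rewrite inE tDe.
have le1 : (#|t |: nonfaces De d A| <= frank (f 0%R))%N.
  apply: frank_triangular => r /setU1P[->|].
    exists (fun o => if o is Some _ then 0 else 1).
    have E q : \sum_a (if a is Some _ then 0 else 1) * f 0 a q = f 0 None q.
      by rewrite sum_option mul1r big1 ?addr0 // => a _; rewrite mul0r.
    split=> [|q _ tq]; rewrite E /f; first by rewrite !inE eqxx.
    by rewrite Dw0 // if_same.
  rewrite inE => /and3P[/inP[v vD [vr vmax]] /eqP rd rA].
  exists (fun o => if o is Some a then v a else 0).
  have E q : \sum_a (if a is Some a then v a else 0) * f 0 a q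
      = if q \in A then gl_act g0 v q else 0.
    rewrite sum_option mul0r add0r gl_act_coef /f B0; case: (q \in A); last first.
      by rewrite big1 // => a _; rewrite !andbF mulr0.
    apply: eq_bigr => a _; have [->|/eqP/vD[-> ->]] := eqVneq (v a) 0.
      by rewrite !mul0r.
    by rewrite rd eqxx.
  split=> [|q _ rq]; rewrite E; first by rewrite rA; apply/eqP.
  case: ifP => // _; apply/eqP/negPn/negP => /eqP vq.
  have qr : q <> r by move=> qr; rewrite qr lt_rev_irr in rq.
  exact: lt_rev_asym rq (vmax q vq qr).
have le2 : (frank (f x) <= proj_rank D d A (g0 *m B x))%N.
  apply: frank_le_proj_rank => -[a|].
    exists (if (a \notin D) && (#|a| == d) then e a else 0).
      move=> q; case: ifP => [/andP[aD /eqP ad]|_]; rewrite ffunE //.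
      by case: eqP => // ->.
    move=> r; rewrite /f andbA; case: ((a \notin D) && (#|a| == d)) => //=.
    by rewrite linear0 ffunE if_same.
  exists (x^-1 *: u) => [q|r].
    by rewrite ffunE => N; apply: uD => z; apply: N; rewrite z scaler0.
  rewrite /f; case: ifP => // rA; rewrite linearZ extZE /= gl_actM BE wA // add0r.
  by rewrite mulKf.
have := leq_trans le1 (leq_trans (pP x px) (leq_trans le2 (rankP A d _ upA))).
by rewrite cardsU1 tC ltnn.
Qed.

(** For the identity matrix the rank is the number of nonfaces in A. *)
Lemma gin_nonfaces_ge Dc (ij : seq ('I_n * 'I_n)) d A : rev_upper A ->
  all (fun p : 'I_n * 'I_n => (p.1 < p.2)%N) ij ->
  Dc = foldl (fun D' (p : 'I_n * 'I_n) => Shift p.1 p.2 D') D ij ->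
  (#|nonfaces Dc d A| <= #|nonfaces De d A|)%N.
Proof.
move=> upA ijP DcE; have [g0 [g0U inP rankP]] := gin_generic Kinf DC DeC De_gin.
have [h] := proj_rank_combinatorial D d A 1%:M ijP.
rewrite -DcE => hP; apply: leq_trans (leq_trans _ hP) (rankP A d h upA).
apply: frank_triangular => r; rewrite inE => /and3P[rDc rd rA].
exists (fun a => (a == r)%:R).
have E q : \sum_a (a == r)%:R * (if [&& a \notin Dc, #|a| == d & q \in A]
    then gl_act 1%:M (e a) q else 0 : K) = if q \in A then (q == r)%:R else 0.
  rewrite (bigD1 r) //= eqxx mul1r rDc rd big1 ?addr0 => [|a /negPf->].
    by rewrite gl_act1 ffunE.
  by rewrite mul0r.
split=> [|q _ rq]; rewrite E; first by rewrite rA eqxx oner_eq0.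
by case: eqP => [qr|_]; rewrite ?if_same // qr lt_rev_irr in rq *.
Qed.

Lemma gin_card_nonfaces_le d : (#|nonfaces De d setT| <= #|nonfaces D d setT|)%N.
Proof.
have [g0 [g0U inP rankP]] := gin_generic Kinf DC DeC De_gin.
apply: (@leq_trans (proj_rank D d setT g0)).
  apply: proj_rank_ge => s; rewrite inE inE => /and3P[sDe /eqP sd _].
  by split=> //; apply/inP.
apply: frank_rows => s t; rewrite inE !in_setT !andbT => N.
by rewrite (negPf N).
Qed.

End GinOfComplex.
End InfiniteField.
End ShiftRank.

(** * Dimensions of quotients *)

Section QuotDim.
Local Open Scope ring_scope.
Variables (K : fieldType) (V : lmodType K) (Z B : V -> Prop).

Lemma quot_dimE b : B 0 -> (forall (a : K) x y, B x -> B y -> B (a *: x + y)) ->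
  is_quot_dim Z B b -> quot_dim Z B = b.
Proof.
move=> B0 BL Hb; have H := epsilon_spec (inhabits 0%N) (is_quot_dim Z B) (ex_intro _ b Hb).
apply/eqP; rewrite eqn_leq -/(quot_dim Z B).
by rewrite (is_quot_dim_le B0 BL H Hb) (is_quot_dim_le B0 BL Hb H).
Qed.

Lemma is_quot_dim_finset (I : finType) (A : {set I}) (v : I -> V) :
  (forall x, x \in A -> Z (v x)) ->
  (forall z, Z z -> exists c : I -> K, B (z - \sum_(x in A) c x *: v x)) ->
  (forall c : I -> K, B (\sum_(x in A) c x *: v x) -> forall x, x \in A -> c x = 0) ->
  is_quot_dim Z B #|A|.
Proof.
move=> vZ vG vF; exists (fun a => v (enum_val a)); split=> [a|z /vG[c cP]|c cB a].
- exact/vZ/enum_valP.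
- exists (fun a => c (enum_val a)).
  by move: cP; rewrite (big_enum_val (fun x => c x *: v x)).
pose c' x := if [pick a : 'I_#|A| | enum_val a == x] is Some a then c a else 0.
have E a' : c' (enum_val a') = c a'.
  rewrite /c'; case: pickP => [b /eqP/enum_val_inj->//|/(_ a')].
  by rewrite eqxx.
rewrite -E; apply: vF (enum_valP a).
rewrite big_enum_val /=; move: cB; congr (B _).
by apply: eq_bigr => b _; rewrite E.
Qed.

End QuotDim.

(** * Monomials and Stanley-Reisner ideals *)

Section Monomials.
Local Open Scope ring_scope.
Variables (K : fieldType) (n : nat).
Local Notation S := {mpoly K[n]}.
Implicit Types (s t T : {set 'I_n}) (m a : 'X_{1..n}) (k l : 'I_n).

Definition mnm_of_set s : 'X_{1..n} := [multinom nat_of_bool (k \in s) | k < n].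

Definition msupport m : {set 'I_n} := [set k | (0 < m k)%N].

Lemma mnm_of_setE s k : mnm_of_set s k = (k \in s). Proof. by rewrite mnmE. Qed.

Lemma msupport_set s : msupport (mnm_of_set s) = s.
Proof. by apply/setP => k; rewrite inE mnm_of_setE lt0b. Qed.

Lemma mdeg_set s : mdeg (mnm_of_set s) = #|s|.
Proof.
rewrite mdegE -sum1_card [RHS]big_mkcond; apply: eq_bigr => k _.
by rewrite mnm_of_setE; case: (k \in s).
Qed.

Lemma mnm_subK k m : (0 < m k)%N -> (m - U_(k) + U_(k))%MM = m.
Proof. by move=> mk; apply: submK; rewrite lep1mP -lt0n. Qed.

Lemma mcoeff_XM k (p : S) m :
  ('X_k * p)@_m = if (0 < m k)%N then p@_(m - U_(k)) else 0.
Proof.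
rewrite mulrC; case: ifP => [mk|mk]; first by rewrite -{1}(mnm_subK mk) addmC mcoeffMX.
apply/eqP; rewrite mcoeff_eq0; apply: contraFN mk => /msuppM_le/allpairsP[[m1 m2] /=].
by case=> _; rewrite msuppX inE => /eqP-> ->; rewrite mnmDE mnm1E eqxx addn1.
Qed.

Lemma prod_X_set s : \prod_(k in s) 'X_k = 'X_[K, mnm_of_set s].
Proof.
rewrite mpolyXE_id big_mkcond; apply: eq_bigr => k _.
by rewrite mnm_of_setE; case: (k \in s).
Qed.

Lemma mpoly_of_coef (F : 'X_{1..n} -> K) (L : seq 'X_{1..n}) :
  (forall m, F m <> 0 -> m \in L) -> exists p : S, forall m, p@_m = F m.
Proof.
move=> FL; exists (\sum_(m <- undup L) F m *: 'X_[m]) => m.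
rewrite raddf_sum /=; have [mL|mL] := boolP (m \in undup L).
  rewrite (bigD1_seq m) ?undup_uniq //= mcoeffZ mcoeffX eqxx mulr1 big1 ?addr0 //.
  by move=> m' /negPf m'm; rewrite mcoeffZ mcoeffX m'm mulr0.
rewrite big_seq big1 => [|m' m'L].
  apply/esym/eqP/negPn/negP => /eqP/FL; rewrite -mem_undup; exact/negP.
rewrite mcoeffZ mcoeffX (_ : m' == m = false) ?mulr0 //.
by apply: contraNF mL => /eqP<-.
Qed.

Lemma stanley_reisnerP (D : {set {set 'I_n}}) (f : S) : simplicial_complex D ->
  stanley_reisner K D f <-> (forall m, f@_m <> 0 -> msupport m \notin D).
Proof.
move=> [_ Dcl]; split=> [[c cG ->] m|fD].
  rewrite raddf_sum /= => /eqP N; have [p pc] : exists2 p, p \in c & (p.1 * p.2)@_m != 0.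
    apply/hasP; apply: contraR N => /hasPn N; rewrite big_seq big1 // => p /N.
    by rewrite negbK => /eqP.
  have [s sD ->] := cG p pc.
  rewrite prod_X_set -mcoeff_msupp => /msuppM_le/allpairsP[[m1 m2] /=].
  rewrite msuppX inE => -[_ /eqP-> ->]; apply: contra sD => /Dcl; apply.
  by apply/subsetP => k ks; rewrite inE mnmDE mnm_of_setE ks addn1.
exists [seq (f@_m *: 'X_[m - mnm_of_set (msupport m)], \prod_(k in msupport m) 'X_k) | m <- msupp f].
  move=> p /mapP[m mf ->]; exists (msupport m) => //; apply: fD.
  by apply/eqP; rewrite -mcoeff_msupp.
rewrite big_map {1}(mpolyE f); apply: eq_bigr => m _ /=.
rewrite prod_X_set -scalerAl -mpolyXD submK //; apply/mnm_lepP => k.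
by rewrite mnm_of_setE inE; case: (m k).
Qed.

End Monomials.

(** * Koszul homology and its toggling homotopies *)

Section KoszulHomology.
Local Open Scope ring_scope.
Variables (K : fieldType) (n : nat).
Implicit Types (v w : koszul K n) (s t T : {set 'I_n}) (m a : 'X_{1..n}) (k l : 'I_n).

Lemma koszul_d_coef v t m : (koszul_d v t)@_m = \sum_(k | (k \notin t) && (0 < m k)%N)
  (-1) ^+ koszul_sign k t * (v (k |: t))@_(m - U_(k)).
Proof.
rewrite ffunE raddf_sum [RHS]big_mkcondr; apply: eq_bigr => k _ /=.
rewrite -mulrA -signr_odd mulr_sign -[in RHS]signr_odd mulr_sign.
by rewrite (fun_if (mcoeff m)) mcoeffN mcoeff_XM; do 2?case: ifP => //; rewrite oppr0.
Qed.

Lemma koszul_lin_coef (c : K) v w s m :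
  ((c *: v + w) s)@_m = c * (v s)@_m + (w s)@_m.
Proof. by rewrite !ffunE mcoeffD mcoeffZ. Qed.

Lemma koszul_ext v w : (forall s m, (v s)@_m = (w s)@_m) -> v = w.
Proof. by move=> vw; apply/ffunP => s; apply/mpolyP => m. Qed.

Lemma koszul_d_is_linear : linear (@koszul_d K n).
Proof.
move=> c v w; apply: koszul_ext => t m; rewrite koszul_lin_coef !koszul_d_coef.
rewrite mulr_sumr -big_split; apply: eq_bigr => k _ /=.
by rewrite koszul_lin_coef mulrDr mulrCA.
Qed.

HB.instance Definition _ :=
  GRing.isLinear.Build K (koszul K n) (koszul K n) _ (@koszul_d K n) koszul_d_is_linear.

Section Complex.
Variable D : {set {set 'I_n}}.
Hypothesis DC : simplicial_complex D.
Local Notation I := (stanley_reisner K D).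

Lemma koszul_tensorP p q v : koszul_tensor I p q v <->
  (forall s m, (v s)@_m <> 0 -> [/\ msupport m \notin D, #|s| = p & (p + mdeg m)%N = q]).
Proof.
split=> [[vp vI vq] s m vm|H].
  have v0 : v s <> 0 by move=> z; apply: vm; rewrite z mcoeff0.
  have [pq /dhomogP hom] := vq s v0; split.
  - by have [/(_ (vI s)) H _] := stanley_reisnerP (v s) DC; apply: H.
  - by have [//|/eqP/vp] := eqVneq #|s| p.
  - by rewrite hom ?subnKC // mcoeff_msupp; apply/eqP.
have coef0 s : v s <> 0 -> exists m, (v s)@_m <> 0.
  move=> v0; case: (altP (msupp (v s) =P [::])) => [/eqP|].
    by rewrite msupp_eq0 => /eqP.
  case E: (msupp (v s)) => [//|m L] _; exists m; apply/eqP.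
  by rewrite -mcoeff_msupp E mem_head.
split=> [s sp|s|s v0].
- have [//|/eqP/coef0[m /H[_ /sp]]] := eqVneq (v s) 0; by [].
- by apply/stanley_reisnerP => // m /H[].
have [m /H[_ _ pm]] := coef0 s v0; split; first by rewrite -pm leq_addr.
apply/dhomogP => m'; rewrite mcoeff_msupp => /eqP/H[_ _ <-].
by rewrite addKn.
Qed.

Lemma koszul_tensor_lin p q (c : K) v w :
  koszul_tensor I p q v -> koszul_tensor I p q w -> koszul_tensor I p q (c *: v + w).
Proof.
move=> /koszul_tensorP vP /koszul_tensorP wP; apply/koszul_tensorP => s m.
rewrite koszul_lin_coef; have [->|/eqP/vP//] := eqVneq ((v s)@_m) 0.
by rewrite mulr0 add0r; apply: wP.
Qed.

Lemma koszul_tensor0 p q : koszul_tensor I p q 0.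
Proof. by apply/koszul_tensorP => s m; rewrite ffunE mcoeff0. Qed.

Lemma koszul_tensor_d p q w :
  (forall s m k, (w s)@_m <> 0 -> k \in s ->
    [/\ msupport (m + U_(k)) \notin D, #|s| = p.+1 & (p.+1 + mdeg m)%N = q]) ->
  koszul_tensor I p q (koszul_d w).
Proof.
move=> wP; apply/koszul_tensorP => t m; rewrite koszul_d_coef => /eqP N.
have [k /and3P[kt mk /eqP wk]] : exists k, [&& k \notin t, (0 < m k)%N &
    (w (k |: t))@_(m - U_(k)) != 0].
  apply/existsP; apply: contraR N => /existsPn N; rewrite big1 // => k /andP[kt mk].
  by have := N k; rewrite kt mk negbK => /eqP->; rewrite mulr0.
have [] := wP _ _ k wk (setU11 _ _); rewrite mnm_subK // cardsU1 kt add1n => mD [tp].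
have -> : mdeg m = (mdeg (m - U_(k))).+1.
  by rewrite -{1}(mnm_subK mk) mdegD mdeg1 addn1.
by rewrite addnS.
Qed.

(** Multiplication by e_k followed by division by x_k, where the variable k is
    selected by the multidegree m + s of x^m e_s. *)
Definition homotopy_coef (sel : 'X_{1..n} -> option 'I_n) v s m : K :=
  if sel (m + mnm_of_set s)%MM is Some k then
    if k \in s then (-1) ^+ koszul_sign k (s :\ k) * (v (s :\ k))@_(m + U_(k)) else 0
  else 0.

Lemma homotopy_ex sel v : exists w : koszul K n,
  forall s m, (w s)@_m = homotopy_coef sel v s m.
Proof.
have H s : exists p : {mpoly K[n]}, forall m, p@_m = homotopy_coef sel v s m.
  pose L := flatten [seq [seq (m - U_(k))%MM | m <- msupp (v (s :\ k))] | k <- enum s].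
  apply: (@mpoly_of_coef _ _ _ L) => m; rewrite /homotopy_coef.
  case: (sel _) => [k|//]; case: ifP => // ks /eqP; rewrite mulf_eq0 signr_eq0 /=.
  rewrite -mcoeff_msupp => mv; apply/flattenP; eexists.
    by apply/mapP; exists k; rewrite ?mem_enum.
  by apply/mapP; exists (m + U_(k))%MM; rewrite ?addmK.
have [p pP] := fin_all_exists H.
by exists [ffun s => p s] => s m; rewrite ffunE.
Qed.

Lemma mnm_of_set_move m t k : k \notin t -> (0 < m k)%N ->
  (m - U_(k) + mnm_of_set (k |: t) = m + mnm_of_set t)%MM.
Proof.
move=> kt mk; apply/mnmP => l; rewrite !(mnmDE, mnmBE, mnm1E, mnm_of_setE) in_setU1.
case: (eqVneq l k) => [->|lk]; first by rewrite (negPf kt) /=; lia.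
by rewrite subn0.
Qed.

(** The Koszul differential preserves the multidegree, hence the selected
    variable; toggling a fixed variable is a contracting homotopy. *)
Lemma homotopyP (sel : 'X_{1..n} -> option 'I_n) v w :
  (forall a l, sel a = Some l -> (0 < a l)%N) -> koszul_d v = 0 ->
  (forall s m, (w s)@_m = homotopy_coef sel v s m) ->
  forall t m, (koszul_d w t)@_m = if sel (m + mnm_of_set t)%MM then (v t)@_m else 0.
Proof.
move=> selP dv wE t m; rewrite koszul_d_coef.
case sel_l: (sel _) => [l|] /=; last first.
  rewrite big1 // => k /andP[kt mk].
  by rewrite wE /homotopy_coef mnm_of_set_move // sel_l mulr0.
have lP := selP _ _ sel_l.
transitivity (\sum_(k | (k \notin t) && (0 < m k)%N) (-1) ^+ koszul_sign k t *
   (if l \in k |: t then (-1) ^+ koszul_sign l ((k |: t) :\ l)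
      * (v ((k |: t) :\ l))@_(m - U_(k) + U_(l)) else 0)).
  by apply: eq_bigr => k /andP[kt mk]; rewrite wE /homotopy_coef mnm_of_set_move // sel_l.
have [lt|lt] := boolP (l \in t); last first.
  have ml : (0 < m l)%N by move: lP; rewrite mnmDE mnm_of_setE (negPf lt) addn0.
  rewrite (bigD1 l) ?lt //= setU11 setU1K // mnm_subK // mulrA -expr2 sqrr_sign mul1r.
  rewrite big1 ?addr0 // => k /andP[_ kl].
  by rewrite !inE eq_sym (negPf kl) (negPf lt) mulr0.
have := congr1 (fun u : koszul K n => (u (t :\ l))@_(m + U_(l))) dv.
rewrite koszul_d_coef ffunE mcoeff0 (bigD1 l) /=; last first.
  by rewrite !inE eqxx mnmDE mnm1E eqxx addn1.
rewrite setD1K // addmK => /eqP; rewrite addr_eq0 => /eqP E.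
transitivity ((-1) ^+ koszul_sign l (t :\ l) *
    ((-1) ^+ koszul_sign l (t :\ l) * (v t)@_m)); last first.
  by rewrite mulrA -expr2 sqrr_sign mul1r.
rewrite E -sumrN mulr_sumr.
apply: eq_big => [k|k /andP[kt mk]].
  rewrite !inE mnmDE mnm1E; case: (eqVneq k l) => [->|kl]; first by rewrite lt !andbF.
  by rewrite addn0 andbT.
have kl : k != l by apply: contraNneq kt => ->.
have lk : l != k by rewrite eq_sym.
have -> : (k |: t) :\ l = k |: (t :\ l).
  by apply/setP => i; rewrite !inE; case: (eqVneq i k) => [->|]; rewrite ?kl.
have -> : (m - U_(k) + U_(l) = m + U_(l) - U_(k))%MM.
  apply/mnmP => i; rewrite !(mnmDE, mnmBE, mnm1E).
  by case: (eqVneq k i) => [<-|_]; rewrite ?subn0 // (negPf lk) !addn0.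
have kU : k \in k |: (t :\ l) by rewrite setU11.
have kN : k \notin t :\ l by rewrite !inE (negPf kt) andbF.
rewrite !inE lt orbT (koszul_signD1 k lt) (koszul_signD1 l kU) setU1K //.
set x := (v _)@_ _; set p := koszul_sign k _; set q := koszul_sign l _.
rewrite mulrA mulrN mulrA -!exprD.
have -> : ((l < k) + p + ((k < l) + q) = (q + p).+1)%N.
  by move: kl; rewrite -val_eqE /=; lia.
by rewrite exprS mulN1r mulNr.
Qed.

End Complex.
End KoszulHomology.

(** * Graded Betti numbers of a shifted complex *)

Section ShiftedBetti.
Local Open Scope ring_scope.
Variables (K : fieldType) (n : nat) (D : {set {set 'I_n}}).
Hypotheses (DC : simplicial_complex D) (Dsh : shifted D) (D0 : set0 \in D).
Variables p q : nat.
Implicit Types (v w : koszul K n) (s t T : {set 'I_n}) (m a : 'X_{1..n}) (k l : 'I_n).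
Local Notation I := (stanley_reisner K D).

Local Notation cell := ('I_n * {set 'I_n} * {set 'I_n})%type.
Implicit Type x : cell.

(** For shifted D the sets k |: T occurring here are the minimal nonfaces, with k
    their largest element, and s runs over the sets of smaller variables outside T,
    as in the Eliahou-Kervaire resolution of a squarefree stable ideal. *)
Definition critical : {set cell} :=
  [set x : cell | let: (k, T, s) := x in
    [&& T \in below n k, s \in below n k, [disjoint T & s], T \in D, k |: T \notin D,
        #|s| == p & (#|s| + #|T|.+1 == q)%N]].

Definition koszul_monomial s m : koszul K n := [ffun t => if t == s then 'X_[m] else 0].

Definition critical_chain x : koszul K n :=
  let: (k, T, s) := x in koszul_monomial (k |: s) (mnm_of_set T).

Definition critical_cycle x : koszul K n := koszul_d (critical_chain x).

Lemma koszul_monomial_coef s m t m' :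
  (koszul_monomial s m t)@_m' = ((t == s) && (m' == m))%:R.
Proof. by rewrite ffunE; case: eqP => _; rewrite ?mcoeff0 // mcoeffX eq_sym. Qed.

Lemma criticalP k T s : reflect
  [/\ forall l, l \in T -> (l < k)%N, forall l, l \in s -> (l < k)%N,
      forall l, l \in T -> l \in s -> False,
      T \in D /\ k |: T \notin D & #|s| = p /\ (#|s| + #|T|.+1)%N = q]
  ((k, T, s) \in critical).
Proof.
rewrite inE; apply: (iffP and5P).
  case=> /belowP Tk /belowP sk Ts TD /and3P[kT /eqP sp /eqP sq].
  split=> //; move=> l lT ls.
  by rewrite (disjointFr Ts lT) in ls.
case=> Tk sk Ts [TD kT] [/eqP sp /eqP sq]; split=> //; try exact/belowP.
  apply/pred0P => l /=; apply/negP => /andP[lT ls]; exact: Ts lT ls.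
by rewrite kT sp sq.
Qed.

(** All the terms x_(l |: T) e_(k |: s minus l) lie in the ideal: for l = k by
    definition, and for l < k because, if l |: T were a face, shiftedness would make
    k |: T one. *)
Lemma critical_cycleP x : x \in critical -> koszul_tensor I p q (critical_cycle x).
Proof.
case: x => -[k T] s /criticalP[Tk sk Ts [TD kTD] [sp sq]].
have kT : k \notin T by apply/negP => /Tk; rewrite ltnn.
have ks : k \notin s by apply/negP => /sk; rewrite ltnn.
rewrite /critical_cycle; apply: (koszul_tensor_d DC) => t m l.
rewrite koszul_monomial_coef.
case: eqP => //= ->; case: eqP => //= -> _ lks; rewrite cardsU1 ks mdeg_set add1n sp.
split=> //; last by rewrite -sq sp addSnnS.
have E : msupport (mnm_of_set T + U_(l))%MM = l |: T.
  apply/setP => i; rewrite !inE mnmDE mnm1E mnm_of_setE; rewrite [i == l]eq_sym.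
  by case: (l == i); rewrite ?addn1 // addn0 lt0b.
rewrite E; case/setU1P: lks => [->//|ls].
have lT : l \notin T by apply/negP => /Ts/(_ ls).
apply: contra kTD => lTD.
have := Dsh lTD (setU11 l T) (sk _ ls); rewrite !inE (negPf kT) orbF setU1K //; apply.
by apply: contraTneq (sk _ ls) => ->; rewrite ltnn.
Qed.

(** The coefficient of x_(k |: T) e_s detects the cycle of (k, T, s) among all
    the critical cycles: k is the largest index of the multidegree, so it can be
    recovered from it. *)
Lemma critical_cycle_coef k0 T0 s0 x : (k0, T0, s0) \in critical -> x \in critical ->
  ((critical_cycle x) s0)@_(mnm_of_set (k0 |: T0)) =
     if x == (k0, T0, s0) then (-1) ^+ koszul_sign k0 s0 else 0.
Proof.
case: x => -[k T] s /criticalP[Tk0 sk0 Ts0 _ _] /criticalP[Tk sk Ts _ _].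
have kT0 : k0 \notin T0 by apply/negP => /Tk0; rewrite ltnn.
have ks0 : k0 \notin s0 by apply/negP => /sk0; rewrite ltnn.
rewrite koszul_d_coef.
have E0 : (mnm_of_set (k0 |: T0) - U_(k0) = mnm_of_set T0)%MM.
  apply/mnmP => l; rewrite !(mnmBE, mnm1E, mnm_of_setE) !inE.
  by case: (eqVneq k0 l) => [<-|_]; rewrite ?(negPf kT0) ?eqxx ?subn0.
have key l : l \notin s0 -> (0 < mnm_of_set (k0 |: T0) l)%N -> l |: s0 = k |: s ->
    (mnm_of_set (k0 |: T0) - U_(l))%MM = mnm_of_set T -> l = k0 /\ (k, T, s) = (k0, T0, s0).
  move=> ls0; rewrite mnm_of_setE lt0b => lkT E1 E2.
  have kk0 : k = k0.
    apply/val_inj/eqP; rewrite eqn_leq; apply/andP; split.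
      have : k \in l |: s0 by rewrite E1 setU11.
      case/setU1P=> [->|/sk0/ltnW//]; case/setU1P: lkT => [->//|/Tk0/ltnW//].
    have [E3|lk0] := eqVneq l k0.
      have : l \in k |: s by rewrite -E1 setU11.
      by rewrite E3 => /setU1P[->//|/sk/ltnW].
    have /(congr1 (fun m : 'X_{1..n} => m k0)) := E2.
    rewrite mnmBE mnm1E !mnm_of_setE setU11 (negPf lk0) subn0.
    by case: (boolP (k0 \in T)) => // /Tk/ltnW.
  subst k.
  have lk0 : l = k0.
    have : k0 \in l |: s0 by rewrite E1 setU11.
    by case/setU1P=> // ks; rewrite ks in ks0.
  subst l; split=> //.
  have ks : k0 \notin s by apply/negP => /sk; rewrite ltnn.
  have -> : s = s0 by rewrite -(setU1K ks) -E1 setU1K.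
  by rewrite -(msupport_set T) -E2 E0 msupport_set.
case: eqP => [[-> -> ->]|ne]; last first.
  rewrite big1 // => l /andP[ls0 lp]; rewrite koszul_monomial_coef.
  case: eqP => [E1|_]; last by rewrite mulr0.
  case: eqP => [E2|_]; last by rewrite mulr0.
  by case: ne; case: (key l ls0 lp E1 E2).
rewrite (bigD1 k0) /=; last by rewrite ks0 mnm_of_setE setU11.
rewrite koszul_monomial_coef E0 !eqxx mulr1 big1 ?addr0 // => l /andP[/andP[ls0 lp] lk0].
rewrite koszul_monomial_coef; case: eqP => [E1|_]; last by rewrite mulr0.
have : k0 \in l |: s0 by rewrite E1 setU11.
by rewrite !inE eq_sym (negPf lk0) (negPf ks0).
Qed.

(** By shiftedness k |: T is a minimal nonface: removing any l < k from it gives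
    the exchange of l for k in the face T.  So no chain with coefficients in the
    ideal has x_(k |: T) e_s in its boundary. *)
Lemma boundary_coef0 k T s w : (k, T, s) \in critical -> koszul_tensor I p.+1 q w ->
  (koszul_d w s)@_(mnm_of_set (k |: T)) = 0.
Proof.
move=> /criticalP[Tk sk Ts [TD kTD] _] /(koszul_tensorP DC) wP.
have kT : k \notin T by apply/negP => /Tk; rewrite ltnn.
rewrite koszul_d_coef big1 // => l /andP[ls]; rewrite mnm_of_setE lt0b => lkT.
have E : msupport (mnm_of_set (k |: T) - U_(l))%MM = (k |: T) :\ l.
  apply/setP => i; rewrite inE mnmBE mnm1E mnm_of_setE !inE [i == l]eq_sym.
  by case: (l == i); rewrite ?subn0 ?lt0b //; case: (_ || _).
have [->|/eqP/wP[]] := eqVneq ((w (l |: s))@_(mnm_of_set (k |: T) - U_(l))) 0.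
  by rewrite mulr0.
rewrite E => /negP[]; case/setU1P: lkT => [->|lT]; first by rewrite setU1K.
have lk : l != k by apply: contraTneq lT => ->.
have -> : (k |: T) :\ l = k |: (T :\ l).
  by apply/setP => i; rewrite !inE; case: (eqVneq i k) => [->|]; rewrite // eq_sym lk.
exact: Dsh TD lT (Tk _ lT) kT.
Qed.

Definition repeated_index a : option 'I_n := [pick l | (1 < a l)%N].
Definition top_index a : option 'I_n := [pick l | (0 < a l)%N && [forall l', (0 < a l')%N ==> (l' <= l)%N]].

Lemma top_index_some a : a != 0%MM -> top_index a.
Proof.
move=> a0; have [l0 al0] : exists l, (0 < a l)%N.
  apply/existsP; apply: contraR a0 => /existsPn N; apply/eqP/mnmP => l.
  by rewrite mnm0E; apply/eqP; rewrite eqn0Ngt N.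
rewrite /top_index; case: pickP => // N.
case: (@arg_maxnP _ l0 (fun l => 0 < a l)%N (fun l => l : nat) al0) => l al lmax.
have := N l; rewrite al /= => /negP[]; apply/forallP => l'; apply/implyP.
exact: lmax.
Qed.

Lemma top_indexP a k : top_index a = Some k -> (0 < a k)%N /\ forall l, (0 < a l)%N -> (l <= k)%N.
Proof.
rewrite /top_index; case: pickP => // k' /andP[ak /forallP kmax] [<-]; split=> // l al.
exact: implyP (kmax l) al.
Qed.

(** Toggling a variable of multidegree at least 2 does not change the support
    of a monomial, hence stays in the ideal. *)
Lemma homotopy_repeated v w : koszul_tensor I p q v ->
  (forall s m, (w s)@_m = homotopy_coef repeated_index v s m) -> koszul_tensor I p.+1 q w.
Proof.
move=> /(koszul_tensorP DC) vP wE; apply/(koszul_tensorP DC) => s m; rewrite wE /homotopy_coef.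
rewrite /repeated_index; case: pickP => // l; rewrite mnmDE mnm_of_setE => al; case: ifP => // ls.
rewrite ls addn1 ltnS in al.
move=> /eqP; rewrite mulf_eq0 signr_eq0 /= => /eqP/vP[vD <- <-].
rewrite [#|s|](cardsD1 l) ls mdegD mdeg1 addn1 addnS; split=> //.
apply: contra vD; rewrite (_ : msupport (m + U_(l))%MM = msupport m) //.
apply/setP => k; rewrite !inE mnmDE mnm1E; case: (eqVneq l k) => [<-|_].
  by rewrite addn1 al.
by rewrite addn0.
Qed.

(** The homotopy for [repeated_index] removes, within the ideal, the part of v in
    multidegrees that are not squarefree.  The remaining part z is the boundary of
    w, its image by the homotopy for [top_index].  A monomial x_T e_s of w has
    its largest variable k in s and k |: T a nonface, so either it is in the ideal or
    it is a critical chain. *)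
Lemma critical_span v : koszul_tensor I p q v -> koszul_d v = 0 ->
  exists c : cell -> K, exists2 w, koszul_tensor I p.+1 q w &
    v - \sum_(x in critical) c x *: critical_cycle x = koszul_d w.
Proof.
move=> vI dv.
have [y yE] := homotopy_ex repeated_index v.
have yI := homotopy_repeated vI yE.
have dy : forall t m, (koszul_d y t)@_m = if repeated_index (m + mnm_of_set t)%MM then (v t)@_m else 0.
  apply: homotopyP yE => // a l; rewrite /repeated_index; case: pickP => // l' al' [<-].
  exact: ltnW.
pose z := -1 *: koszul_d y + v.
have zE t m : (z t)@_m = if repeated_index (m + mnm_of_set t)%MM then 0 else (v t)@_m.
  rewrite koszul_lin_coef dy mulN1r; case: ifP => _; first by rewrite addNr.
  by rewrite oppr0 add0r.
have dz : koszul_d z = 0 by rewrite /z linearP /= koszul_dd dv scaler0 addr0.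
move/(koszul_tensorP DC): (vI) => vP.
have zP s m : (z s)@_m <> 0 ->
    [/\ msupport m \notin D, #|s| = p, (p + mdeg m)%N = q & forall l, ((m + mnm_of_set s)%MM l <= 1)%N].
  rewrite zE /repeated_index; case: pickP => //= N /vP[mD sp mq]; split=> // l.
  by rewrite leqNgt N.
have [w wE] := homotopy_ex top_index z.
have dw : koszul_d w = z.
  apply: koszul_ext => t m; rewrite (@homotopyP _ _ top_index z w _ dz wE).
    case: ifP => // N; have [->//|/eqP/zP[mD _ _ _]] := eqVneq ((z t)@_m) 0.
    have : (m + mnm_of_set t == 0)%MM by apply: contraFT N; apply: top_index_some.
    move/eqP/mnmP => m0; case/negP: mD; rewrite (_ : msupport m = set0) //.
    by apply/setP => l; rewrite !inE; have := m0 l; rewrite mnmDE mnm0E; case: (m l).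
  by move=> a l /top_indexP[].
pose c x := let: (k, T, s) := x in (w (k |: s))@_(mnm_of_set T).
have wP s m : (w s)@_m <> 0 -> exists k, let T := msupport m in
    [/\ s = k |: (s :\ k), m = mnm_of_set T, (T \in D -> (k, T, s :\ k) \in critical),
        #|s| = p.+1 & (p.+1 + mdeg m)%N = q] /\
    (k |: T \notin D /\ forall l, l \in s -> (l <= k)%N).
  rewrite wE /homotopy_coef; case top_k: (top_index _) => [k|//]; case: ifP => // ks.
  move=> /eqP; rewrite mulf_eq0 signr_eq0 /= => /eqP/zP[kD sp mq le1].
  have {}le1 l : (m l + (l \in s) <= 1)%N.
    move: (le1 l); rewrite !(mnmDE, mnm1E, mnm_of_setE) !inE.
    by case: (eqVneq l k) => [->|lk]; rewrite ?ks /= addn0.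
  have [_ kmax] := top_indexP top_k.
  have kmax' l : (l \in s) || (0 < m l)%N -> (l <= k)%N.
    by move=> H; apply: kmax; rewrite mnmDE mnm_of_setE; case: (l \in s) H => /=; lia.
  have lt_k l : (l <= k)%N -> l != k -> (l < k)%N.
    by rewrite ltn_neqAle => -> ->.
  have Ts l : (0 < m l)%N -> l \in s -> False.
    by move=> ml ls; have := le1 l; rewrite ls; lia.
  have mT : m = mnm_of_set (msupport m).
    by apply/mnmP => l; rewrite mnm_of_setE inE; have := le1 l; case: (m l) => [|[|]].
  have kT : msupport (m + U_(k))%MM = k |: msupport m.
    apply/setP => l; rewrite !inE mnmDE mnm1E eq_sym.
    by case: (eqVneq l k) => _; rewrite ?addn1 ?addn0.
  have s_p : #|s| = p.+1 by rewrite (cardsD1 k) ks sp.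
  have m_q : (p.+1 + mdeg m)%N = q by rewrite -mq mdegD mdeg1 addn1 addnS.
  exists k => /=; rewrite setD1K //; split.
    split=> // TD; apply/criticalP; rewrite -kT; split=> //.
    - move=> l; rewrite inE => ml; apply: lt_k; first by rewrite kmax' // ml orbT.
      by apply/eqP => lk; apply: (Ts l ml); rewrite lk.
    - by move=> l; rewrite !inE => /andP[lk ls]; apply: lt_k; rewrite ?kmax' ?ls.
    - by move=> l; rewrite !inE => ml /andP[_]; apply: Ts.
    by split=> //; rewrite sp -m_q {2}mT mdeg_set addnS.
  by split; [rewrite -kT|move=> l ls; rewrite kmax' ?ls].
exists c, (y + (w - \sum_(x in critical) c x *: critical_chain x)); last first.
  rewrite !(linearD, linearN) /= dw /z scaleN1r addrA addrA subrr add0r.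
  congr (_ - _); rewrite linear_sum; apply: eq_bigr => x _.
  by rewrite linearZ.
rewrite -[y]scale1r; apply: koszul_tensor_lin => //.
apply/(koszul_tensorP DC) => s m.
rewrite ffunE mcoeffD ffunE sum_ffunE mcoeffN raddf_sum /=.
pose hit x := let: (k, T, s') := x in (s == k |: s') && (m == mnm_of_set T).
have -> : \sum_(x in critical) ((c x *: critical_chain x) s)@_m
    = \sum_(x in critical | hit x) (w s)@_m.
  rewrite [RHS]big_mkcondr; apply: eq_bigr => -[[k T] s'] _.
  rewrite ffunE mcoeffZ koszul_monomial_coef /=; case: eqP => [->|_]; last by rewrite mulr0.
  by case: eqP => [->|_]; rewrite ?mulr1 ?mulr0.
have [->|/eqP ws] := eqVneq ((w s)@_m) 0; first by rewrite big1 ?subrr.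
have [k [[sE mE crit sp mq] [kD kmax]]] := wP s m ws.
have [TD|TD _] := boolP (msupport m \in D); last by [].
rewrite (big_pred1 (k, msupport m, s :\ k)) ?subrr // => -[[k' T'] s'] /=.
apply/andP/eqP => [[/criticalP[_ s'k' _ _ _] /andP[/eqP E1 /eqP E2]]|[-> -> ->]]; last first.
  by rewrite crit // -sE -mE !eqxx.
have k's' : k' \notin s' by apply/negP => /s'k'; rewrite ltnn.
have kk' : k' = k.
  apply/val_inj/eqP; rewrite eqn_leq kmax ?E1 ?setU11 //=.
  have : k \in k' |: s' by rewrite -E1 sE setU11.
  by case/setU1P => [->//|/s'k'/ltnW].
by rewrite -kk' E1 setU1K // E2 msupport_set.
Qed.

Lemma betti_critical : betti I p q = #|critical|.
Proof.
apply: quot_dimE.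
- by exists 0; [apply: koszul_tensor0|rewrite linear0].
- move=> a x y [w wI ->] [w' w'I ->]; exists (a *: w + w'); last by rewrite linearP.
  exact: koszul_tensor_lin.
apply: (@is_quot_dim_finset _ _ _ _ _ _ critical_cycle).
- by move=> x /critical_cycleP xI; split; rewrite ?koszul_dd.
- move=> v [vI dv]; have [c [w wI E]] := critical_span vI dv.
  by exists c; exists w.
move=> c [w wI E] [[k T] s] x_cr.
have := boundary_coef0 x_cr wI; rewrite -E sum_ffunE raddf_sum /= (bigD1 (k, T, s)) //=.
rewrite ffunE mcoeffZ critical_cycle_coef // eqxx big1 ?addr0.
  by move/eqP; rewrite mulf_eq0 signr_eq0 orbF => /eqP.
move=> x /andP[xc /negPf xN].
by rewrite ffunE mcoeffZ critical_cycle_coef // xN mulr0.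
Qed.

End ShiftedBetti.

(** * Betti numbers in terms of counts of nonfaces *)

Section Counting.
Variable n : nat.
Implicit Types (s t T : {set 'I_n}) (k l : 'I_n) (D : {set {set 'I_n}}).

Lemma card_lt k : #|[set l : 'I_n | (l < k)%N]| = k.
Proof.
rewrite -sum1_card (eq_bigl (fun l : 'I_n => (l < k)%N)) => [|l]; last by rewrite inE.
by rewrite -(big_ord_widen n (fun=> 1%N) (ltnW (ltn_ord k))) sum1_card card_ord.
Qed.

Lemma below_subset k T : (T \in below n k) = (T \subset [set l : 'I_n | (l < k)%N]).
Proof.
by apply/belowP/subsetP => H l /H; rewrite inE.
Qed.

Lemma card_disjoint_draws k T i : T \in below n k ->
  #|[set s : {set 'I_n} | [&& s \in below n k, [disjoint T & s] & #|s| == i]]| = 'C(k - #|T|, i).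
Proof.
rewrite below_subset => Tk; rewrite -[in RHS](card_lt k) -[in RHS](setIidPr Tk).
rewrite -cardsD -cards_draws; apply: eq_card => s.
by rewrite !in_set below_subset subsetD -andbA disjoint_sym.
Qed.

Definition new_generators D d k : {set {set 'I_n}} :=
  [set T | [&& T \in below n k, T \in D, k |: T \notin D & #|T| == d]].

Lemma card_critical D i d :
  #|critical D i (i + d.+1)| = (\sum_(k < n) #|new_generators D d k| * 'C(k - d, i))%N.
Proof.
transitivity (\sum_(k < n) \sum_(T in new_generators D d k)
    \sum_(s : {set 'I_n} | [&& s \in below n k, [disjoint T & s] & #|s| == i]) 1)%N.
  rewrite pair_big_dep pair_big_dep /= -sum1_card; apply: eq_bigl => -[[k T] s] /=.
  rewrite !in_set; case: (s \in below n k); case: (T \in below n k);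
    case: [disjoint T & s]; case: (T \in D); case: (_ \in D) => //=; rewrite ?andbF //.
  by case: (eqVneq #|s| i) => [->|]; rewrite ?andbF ?andbT //= eqn_add2l eqSS.
apply: eq_bigr => k _; rewrite -sum_nat_const; apply: eq_bigr => T.
rewrite in_set => /and4P[Tk _ _ /eqP <-]; rewrite -(card_disjoint_draws i Tk) -sum1_card.
by apply: eq_bigl => s; rewrite in_set.
Qed.

(** A nonface below k + 1 containing k is k |: T, where T is a face or not. *)
Lemma card_nonfaces_below D d k : simplicial_complex D ->
  (#|new_generators D d k| + (#|nonfaces D d.+1 (below n k)| + #|nonfaces D d (below n k)|)
    = #|nonfaces D d.+1 (below n k.+1)|)%N.
Proof.
move=> [_ Dcl].
have below_notin T : T \in below n k -> k \notin T.
  by move/belowP => Tk; apply/negP => /Tk; rewrite ltnn.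
pose cone := [set T | [&& T \in below n k, k |: T \notin D & #|T| == d]].
have -> : (#|new_generators D d k| + (#|nonfaces D d.+1 (below n k)| + #|nonfaces D d (below n k)|)
    = #|cone| + #|nonfaces D d.+1 (below n k)|)%N.
  rewrite addnCA addnC -(cardsID D cone); congr (_ + _ + _)%N; apply: eq_card => T.
    by rewrite !(in_set, in_setI); case: (T \in D); rewrite ?andbF ?andbT.
  rewrite in_setD !in_set; case: (boolP (T \in D)) => //= TD.
  rewrite (_ : k |: T \notin D); first by rewrite andbC.
  by apply: contra TD => /Dcl; apply; apply: subsetUr.
rewrite -(cardsID [set s : {set 'I_n} | k \in s] (nonfaces D d.+1 (below n k.+1))).
congr (_ + _)%N.
  rewrite -(@card_in_imset _ _ (fun T => k |: T) (mem cone)); last first.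
    move=> T T'; rewrite !in_set => /and3P[/below_notin Tk _ _] /and3P[/below_notin Tk' _ _] E.
    by rewrite -(setU1K Tk) E setU1K.
  apply: eq_card => s; rewrite in_setI !in_set; apply/imsetP/andP.
    case=> T; rewrite in_set => /and3P[Tk kTD /eqP Td] ->.
    rewrite kTD cardsU1 below_notin // Td add1n eqxx setU11 !andTb; split=> //.
    move/belowP: Tk => Tk.
    by apply/belowP => l /setU1P[->//|/Tk/leqW].
  case=> /and3P[sD sd /belowP sk] ks; exists (s :\ k); last by rewrite setD1K.
  rewrite in_set setD1K // sD; move: sd; rewrite (cardsD1 k) ks eqSS => ->.
  rewrite !andbT; apply/belowP => l; rewrite in_setD1 => /andP[lk /sk].
  by rewrite ltnS leq_eqVlt => /orP[/eqP/val_inj E|//]; rewrite E eqxx in lk.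
apply: eq_card => s; rewrite in_setD !in_set; apply/and3P/andP.
  case=> -> -> sk; rewrite below_notin //; split=> //=; move/belowP: sk => sk.
  by apply/belowP => l /sk/leqW.
case=> ks /and3P[-> -> /belowP sk]; split=> //; apply/belowP => l ls.
move: (sk l ls); rewrite ltnS leq_eqVlt => /orP[/eqP/val_inj E|//].
by rewrite -E ls in ks.
Qed.

End Counting.

(** Summation by parts for the differences e k - f k, with nondecreasing weights:
    the partial sums up to m differ by at most c m * (e m - f m), which vanishes for
    m = n. *)
Lemma weighted_increments_le (n : nat) (c : nat -> nat) (Ne Nc e f e' f' : nat -> nat) :
  {homo c : k l / k <= l} -> (forall k, k <= n -> f k <= e k) -> (forall k, f' k <= e' k) ->
  (forall k, k < n -> Ne k + (e k + e' k) = e k.+1) ->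
  (forall k, k < n -> Nc k + (f k + f' k) = f k.+1) ->
  e n = f n ->
  \sum_(k < n) Ne k * c k <= \sum_(k < n) Nc k * c k.
Proof.
move=> c_homo le_fe le_fe' NeE NcE en.
suff /(_ n (leqnn n)) : forall m, m <= n ->
    \sum_(k < m) Ne k * c k + c m * f m <= \sum_(k < m) Nc k * c k + c m * e m.
  by rewrite en leq_add2r.
elim=> [|m IHm] lt_mn; first by rewrite !big_ord0 !add0n leq_mul2l le_fe ?orbT.
have := IHm (ltnW lt_mn); rewrite !big_ord_recr /=.
have h1 : c m * f' m <= c m * e' m by rewrite leq_mul2l le_fe' orbT.
have h2 := le_fe _ lt_mn; have h3 := c_homo _ _ (leqnSn m).
move: (NeE _ lt_mn) (NcE _ lt_mn) h1 h2 h3.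
move: (\sum_(k < m) _) (\sum_(k < m) _) (c m) (c m.+1) => X Y a b.
move: (Ne m) (Nc m) (e m) (e' m) (f m) (f' m) (e m.+1) (f m.+1).
move=> ne nc E E' F F' G H <- <- h1 h2 h3 h4.
have h5 : a * (ne + (E + E')) + b * (nc + (F + F')) <= a * (nc + (F + F')) + b * (ne + (E + E')).
  nia.
nia.
Qed.

Theorem theorem2p10 (K : fieldType) (n : nat) (D De Dc : {set {set 'I_n}})
    (Kinf : infinite_field K) (D_complex : simplicial_complex D)
    (De_shift : exterior_shifted K D De)
    (Dc_shift : combinatorial_shifted D Dc)
    (i j : nat) :
  (betti (stanley_reisner K De) i (i + j)
     <= betti (stanley_reisner K Dc) i (i + j))%N.
Proof.
have [De_complex De_gin] := De_shift.
have [Dc_shifted [ij ijP DcE]] := Dc_shift.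
have De_shifted : shifted De := gin_shifted Kinf D_complex De_complex De_gin.
have [Dc_complex cardDc] : simplicial_complex Dc /\
    forall d, #|nonfaces Dc d setT| = #|nonfaces D d setT|.
  rewrite DcE; move: ijP D_complex; clear.
  elim: ij D => [|p ij IH] D //= /andP[lt_p ijP] DC.
  have ne_p : p.1 != p.2 by apply: contraTneq lt_p => ->; rewrite ltnn.
  have [? E] := IH _ ijP (Shift_complex ne_p DC).
  by split=> // d; rewrite E card_nonfaces_Shift.
have ge d A : rev_upper A -> #|nonfaces Dc d A| <= #|nonfaces De d A|.
  by move=> upA; apply: (gin_nonfaces_ge Kinf D_complex De_complex De_gin d upA ijP DcE).
have eqT d : #|nonfaces De d setT| = #|nonfaces Dc d setT|.
  apply/eqP; rewrite eqn_leq; apply/andP; split; last by apply: ge => s t; rewrite !in_setT.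
  by rewrite cardDc (gin_card_nonfaces_le Kinf D_complex De_complex De_gin).
have face0 (D' : {set {set 'I_n}}) : (set0 \in D') = (#|nonfaces D' 0 setT| == 0).
  rewrite cards_eq0; apply/idP/eqP => [D0|N].
    apply/setP => s; rewrite !in_set cards_eq0; case: eqP => [->|]; rewrite ?D0 ?andbF //.
  apply/negPn/negP => D0; have : set0 \in nonfaces D' 0 setT by rewrite !in_set D0 cards0.
  by rewrite N in_set0.
have DcDe0 : (set0 \in De) = (set0 \in Dc) by rewrite !face0 eqT.
(* Without the empty face both complexes are empty; this happens only for n = 0. *)
have [Dc0|Dc0] := boolP (set0 \in Dc); last first.
  have empty (D' : {set {set 'I_n}}) : simplicial_complex D' -> set0 \notin D' -> D' = set0.
    move=> [_ cl] N; apply/setP => s; rewrite in_set0; apply: contraNF N => /cl; apply.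
    exact: sub0set.
  have EDc : Dc = set0 by apply: empty.
  have EDe : De = set0 by apply: empty; rewrite // DcDe0.
  by rewrite EDe EDc; apply: leqnn.
have De0 : set0 \in De by rewrite DcDe0.
rewrite !betti_critical //; case: j => [|d].
  rewrite [X in X <= _](_ : _ = 0) //; apply/eqP; rewrite cards_eq0; apply/eqP/setP => -[[k T] s].
  rewrite !in_set; apply/negP => /and5P[_ _ _ _ /and3P[_ /eqP ->]].
  by rewrite eqn_add2l.
have belown d' (D' : {set {set 'I_n}}) : nonfaces D' d' (below n n) = nonfaces D' d' setT.
  apply/setP => s; rewrite !in_set (_ : s \in below n n) //.
  by apply/belowP => l _.
rewrite !card_critical.
pose N (D' : {set {set 'I_n}}) k := if insub k is Some k' then #|new_generators D' d k'| else 0.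
have NE (D' : {set {set 'I_n}}) : \sum_(k < n) #|new_generators D' d k| * 'C(k - d, i)
    = \sum_(k < n) N D' k * 'C(k - d, i).
  by apply: eq_bigr => k _; rewrite /N valK.
rewrite !NE; apply: (weighted_increments_le
  (e := fun k => #|nonfaces De d.+1 (below n k)|) (e' := fun k => #|nonfaces De d (below n k)|)
  (f := fun k => #|nonfaces Dc d.+1 (below n k)|) (f' := fun k => #|nonfaces Dc d (below n k)|)
  (c := fun k => 'C(k - d, i))).
- by move=> k l kl; apply: leq_bin2l; apply: leq_sub2r.
- by move=> k _; apply/ge/below_upper.
- by move=> k; apply/ge/below_upper.
- by move=> k lt_kn; rewrite /N insubT /= (card_nonfaces_below d (Ordinal lt_kn)).
- by move=> k lt_kn; rewrite /N insubT /= (card_nonfaces_below d (Ordinal lt_kn)).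
- by rewrite /= !belown.
Qed.
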